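(* Let $a<b$, $n\ge1$, let $B\in\mathbb{R}^{2n\times4n}$ have row rank $2n$, and let $B_a$ be the function determined by $B$ as in the context. Let $M:[a,b]\to\mathbb{R}^{n\times n}$ and $N_1,N_2:[a,b]\times[a,b]\to\mathbb{R}^{n\times n}$. Suppose $x\in W^{3,2}[a,b]$ is $\mathbb{R}^n$-valued and $B\begin{bmatrix}x(a)^T&x(b)^T&x_s(a)^T&x_s(b)^T\end{bmatrix}^T=0$. Then $$\langle x,\mathcal{P}_{\{M,N_1,N_2\}}x\rangle_{L_2}=\langle x_{ss},\mathcal{P}_{\{0,T_1,T_2\}}x_{ss}\rangle_{L_2},$$ where $T_1(s,\theta)=G_1(s,\theta)+G_3(s,\theta)$, $T_2(s,\theta)=G_2(s,\theta)+G_3(s,\theta)$, and $$G_1(s,\theta)=\int_s^b\big((\eta-s)G_4(\theta,\eta)+G_5(s,\theta,\eta)\big)\,d\eta,$$ $$G_2(s,\theta)=\int_\theta^b\big((\eta-s)G_4(\theta,\eta)+G_5(s,\theta,\eta)\big)\,d\eta,$$ $$G_3(s,\theta)=\int_a^bB_a(\eta,s)^TY_3(\eta,\theta)\,d\eta+\int_\theta^b(\eta-\theta)Y_1(s,\eta)\,d\eta+\int_s^b(\eta-s)Y_3(\eta,\theta)\,d\eta,$$ $$G_4(\theta,\eta)=(\eta-\theta)M(\eta)+\int_\theta^\eta(\zeta-\theta)N_1(\eta,\zeta)\,d\zeta,$$ $$G_5(s,\theta,\eta)=\int_s^\eta(\zeta-s)(\eta-\theta)N_2(\zeta,\eta)\,d\zeta,$$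 with $$Y_1(s,\eta)=B_a(\eta,s)^TM(\eta)+\int_\eta^bB_a(\theta,s)^TN_1(\theta,\eta)\,d\theta+\int_a^\eta B_a(\theta,s)^TN_2(\theta,\eta)\,d\theta,$$ $$Y_3(\zeta,\eta)=M(\zeta)B_a(\zeta,\eta)+\int_a^\zeta N_1(\zeta,\theta)B_a(\theta,\eta)\,d\theta+\int_\zeta^bN_2(\zeta,\theta)B_a(\theta,\eta)\,d\theta .$$
   Context: The operator $\mathcal{P}_{\{M,N_1,N_2\}}:L_2^n[a,b]\to L_2^n[a,b]$ is $$(\mathcal{P}_{\{M,N_1,N_2\}}x)(s)=M(s)x(s)+\int_a^sN_1(s,\theta)x(\theta)\,d\theta+\int_s^bN_2(s,\theta)x(\theta)\,d\theta,$$ with $M,N_1,N_2$ regular enough (e.g. bounded measurable) that this is a well-defined operator on $L_2^n[a,b]$ and the integrals in the statement exist. $L_2^n[a,b]$ has the standard inner product $\langle x,y\rangle_{L_2}=\int_a^bx(s)^Ty(s)\,ds$. $x_s,x_{ss}$ are first and second derivatives in $s$. $W^{k,2}[a,b]$ is the Sobolev space of functions with derivatives up to order $k$ in $L_2$. Definition of $B_a$ (with $I,0$ being $n\times n$ blocks): $$B_2=B\begin{bmatrix} I & 0 \\ I & (b-a)I \\ 0 & I \\ 0 & I \end{bmatrix},\quad B_3=-B_2^{-1}B\begin{bmatrix} 0 & 0 \\ I & 0 \\ 0 & 0 \\ 0 & I \end{bmatrix},\quad\begin{bmatrix}B_4(s)&B_5(s)\end{bmatrix}=\begin{bmatrix}I&(s-a)I\end{bmatrix}B_3,$$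 $$B_a(s,\eta)=B_4(s)(b-\eta)+B_5(s).$$
   Formalization: The formal theorem also assumes that B_2 is invertible: row rank 2n of B does not imply it (e.g. the conditions x_s(a)=x_s(b)=0), and B_a is undefined without it. M, N_1, N_2 are taken bounded and measurable. *)

(* Defs.v *)
From HB Require Import structures.
From mathcomp Require Import all_boot all_order all_algebra.
From mathcomp Require Import all_classical all_reals all_analysis.
Import Order.TTheory GRing.Theory Num.Theory.
Import numFieldNormedType.Exports.

Set Implicit Arguments.
Unset Strict Implicit.
Unset Printing Implicit Defensive.

Local Open Scope classical_set_scope.
Local Open Scope ring_scope.

(** Entrywise Lebesgue integral of a matrix-valued function over [[a, b]].  It
    is unsigned: for [b < a] it is [0].  Below it only matters for [a <= b]. *)
Definition mxint {R : realType} {m p : nat} (a b : R) (F : R -> 'M[R]_(m, p))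
    : 'M[R]_(m, p) :=
  \matrix_(i < m, j < p) (\int[lebesgue_measure]_(t in `[a, b]) F t i j)%R.

Section FunctionSpaces.
Context {R : realType} {n : nat}.
Implicit Types (a b s t : R) (k : nat) (phi : R -> R) (u v c : R -> 'cV[R]_n).

(** L_2^n[a, b].  As usual in the library, functions are defined on all of [R];
    only their values on [[a, b]] matter. *)
Definition L2 a b u : Prop :=
  forall i, (fun t => u t i ord0) \_ `[a, b] \in Lfun (@lebesgue_measure R) 2%:E.

Definition L2_inner a b u v : R :=
  (\int[lebesgue_measure]_(s in `[a, b]) ((u s)^T *m v s) ord0 ord0)%R.

(** C^1 functions with compact support in the open interval ]a, b[. *)
Definition test_function a b phi : Prop :=
  [/\ forall t, derivable phi t 1,
      continuous (derive1 phi)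
    & closure [set t | phi t != 0] `<=` `]a, b[ ].

(** [v] is (a representative of) the L_2 weak derivative of [u] on ]a, b[. *)
Definition weak_derivative a b u v : Prop :=
  L2 a b v /\
  forall phi, test_function a b phi ->
    mxint a b (fun t => derive1 phi t *: u t) = - mxint a b (fun t => phi t *: v t).

(** W^{k,2}[a, b] *)
Fixpoint sobolev2 k a b u : Prop :=
  L2 a b u /\
  if k is k'.+1 then exists v, weak_derivative a b u v /\ sobolev2 k' a b v
  else True.

(** Elements of L_2 and W^{k,2} are functions up to a.e. equality.  Point values
    of an element of W^{1,2}[a, b] are those of its continuous representative on
    [[a, b]], which exists and is unique there.  (For a function without
    continuous representative the value below is the junk value [u t].) *)
Definition continuous_representative a b u c : Prop :=
  {within `[a, b], continuous c} /\
  {ae @lebesgue_measure R, forall t, `[a, b]%classic t -> c t = u t}.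

Definition value_at a b u t : 'cV[R]_n :=
  xget u [set c | continuous_representative a b u c] t.

End FunctionSpaces.

Definition bounded_measurable {R : realType} {d : measure_display}
    {T : measurableType d} {m p : nat} (D : set T) (F : T -> 'M[R]_(m, p))
    : Prop :=
  forall i j, measurable_fun D (fun t => F t i j) /\
              [bounded F t i j | t in D].

Section Operators.
Context {R : realType} {n : nat}.
Variables a b : R.

Definition opP (M : R -> 'M[R]_n) (N1 N2 : R -> R -> 'M[R]_n)
    (x : R -> 'cV[R]_n) (s : R) : 'cV[R]_n :=
  M s *m x s + mxint a s (fun theta => N1 s theta *m x theta)
             + mxint s b (fun theta => N2 s theta *m x theta).

Variable B : 'M[R]_(n + n, (n + n) + (n + n)).

Definition B_2 : 'M[R]_(n + n) :=
  B *m col_mx (col_mx (row_mx 1%:M 0) (row_mx 1%:M (b - a)%:M))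
              (col_mx (row_mx 0 1%:M) (row_mx 0 1%:M)).

Definition B_3 : 'M[R]_(n + n) :=
  - (invmx B_2 *m B *m
     col_mx (col_mx (row_mx 0 0) (row_mx 1%:M 0))
            (col_mx (row_mx 0 0) (row_mx 0 1%:M))).

Definition B_45 (s : R) : 'M[R]_(n, n + n) := row_mx 1%:M (s - a)%:M *m B_3.
Definition B_4 (s : R) : 'M[R]_n := lsubmx (B_45 s).
Definition B_5 (s : R) : 'M[R]_n := rsubmx (B_45 s).

Definition B_a (s eta : R) : 'M[R]_n := (b - eta) *: B_4 s + B_5 s.

Variables (M : R -> 'M[R]_n) (N1 N2 : R -> R -> 'M[R]_n).

Definition Y_1 (s eta : R) : 'M[R]_n :=
  (B_a eta s)^T *m M eta
  + mxint eta b (fun theta => (B_a theta s)^T *m N1 theta eta)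
  + mxint a eta (fun theta => (B_a theta s)^T *m N2 theta eta).

Definition Y_3 (zeta eta : R) : 'M[R]_n :=
  M zeta *m B_a zeta eta
  + mxint a zeta (fun theta => N1 zeta theta *m B_a theta eta)
  + mxint zeta b (fun theta => N2 zeta theta *m B_a theta eta).

Definition G_4 (theta eta : R) : 'M[R]_n :=
  (eta - theta) *: M eta
  + mxint theta eta (fun zeta => (zeta - theta) *: N1 eta zeta).

Definition G_5 (s theta eta : R) : 'M[R]_n :=
  mxint s eta (fun zeta => ((zeta - s) * (eta - theta)) *: N2 zeta eta).

(** In [T_1] (resp. [T_2]) only the arguments with [theta <= s] (resp.
    [s <= theta]) enter [opP], so all the integrals below that matter have
    ordered bounds. *)
Definition G_1 (s theta : R) : 'M[R]_n :=
  mxint s b (fun eta => (eta - s) *: G_4 theta eta + G_5 s theta eta).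

Definition G_2 (s theta : R) : 'M[R]_n :=
  mxint theta b (fun eta => (eta - s) *: G_4 theta eta + G_5 s theta eta).

Definition G_3 (s theta : R) : 'M[R]_n :=
  mxint a b (fun eta => (B_a eta s)^T *m Y_3 eta theta)
  + mxint theta b (fun eta => (eta - theta) *: Y_1 s eta)
  + mxint s b (fun eta => (eta - s) *: Y_3 eta theta).

Definition T_1 (s theta : R) : 'M[R]_n := G_1 s theta + G_3 s theta.
Definition T_2 (s theta : R) : 'M[R]_n := G_2 s theta + G_3 s theta.

End Operators.

(* Main.v *)
Require Import Defs.
From HB Require Import structures.
From mathcomp Require Import all_boot all_order all_algebra.
From mathcomp Require Import all_classical all_reals all_analysis.
From mathcomp Require Import measurable_realfun ring lra.
Import Order.TTheory GRing.Theory Num.Theory.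
Import numFieldNormedType.Exports.

Set Implicit Arguments.
Unset Strict Implicit.
Unset Printing Implicit Defensive.

Local Open Scope classical_set_scope.
Local Open Scope ring_scope.

(** By the du Bois-Reymond lemma, [x] and [x_s] are a.e. equal to primitives of
    [x_s] and [x_ss], so Taylor's formula
    [x(t) = x(a) + (t - a) x_s(a) + int_a^t (t - e) x_ss(e) de] holds a.e., with
    the point values of the continuous representatives.  Inserting it in the
    boundary condition and inverting [B_2] expresses [x(a)] and [x_s(a)] through
    [x_ss], whence [x = int_a^b K(., e) x_ss(e) de] with
    [K(t, e) = B_a(t, e) + max(0, t - e)].  By Fubini's theorem
    [<x, P x> = <x_ss, (K^* P K) x_ss>], and [K^* P K] is an integral operator;
    expanding the two summands of both copies of [K], and exchanging the order
    of integration once more, its kernel is [T_1] below and [T_2] above the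
    diagonal. *)

(** * Bounded measurable functions *)

(** [x_ss] is integrable but need not be bounded, while every kernel is bounded on the square. All
    exchanges of order therefore concern a product of an integrable function of s, a bounded kernel
    and an integrable function of t, dominated by some g(s) h(t); the resulting Fubini theorem is
    used as the associativity law [mxint_assoc]. For this, integrals with a variable end are
    rewritten over [a, b], with an indicator absorbed in the kernel.

    Write p for the kernel max(0, t - e). Of the four terms of K^* P K, the three containing [B_a]
    make up [G_3]; the fourth, p^* P p, is the only one whose formula distinguishes the order of its
    arguments, and it gives [G_1] or [G_2]. These kernel identities hold at every point of the
    square, diagonal included.

    Hypothesis [hB2] states what the inverse of [B_2] in [B_3] presupposes. Full row rank alone does
    not give it: for the conditions x_s(a) = x_s(b) = 0, [B_2] is singular. *)

Definition bnd_mfun {R : realType} {d} {T : measurableType d} (D : set T)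
    (f : T -> R) : Prop :=
  measurable_fun D f /\ [bounded f t | t in D].

Section BoundedMeasurable.
Context {R : realType} {d : measure_display} {T : measurableType d}.
Implicit Types (D : set T) (f g : T -> R).

Lemma bnd_mfunP D f : bnd_mfun D f <->
  measurable_fun D f /\ exists2 C, 0 <= C & forall t, D t -> `|f t| <= C.
Proof.
split=> -[mf bf]; split=> //.
  have [C [_ Cb]] := bf.
  (* Library boundedness gives a bound by every number strictly above [C], hence the [+ 1]. *)
  exists (`|C| + 1); first by rewrite addr_ge0.
  by move=> t Dt; apply: Cb => //; rewrite ltr_pwDr// ler_norm.
have [C C0 Cb] := bf.
exists C; split; first exact: num_real.
by move=> x Cx t Dt; apply: le_trans (Cb t Dt) (ltW Cx).
Qed.

End BoundedMeasurable.

Section BoundedMeasurableClosure.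
Context {R : realType} {d : measure_display} {T : measurableType d}.
Implicit Types (D : set T) (f g : T -> R).

Lemma bnd_mfun_cst D (c : R) : bnd_mfun D (fun=> c).
Proof. by apply/bnd_mfunP; split=> //; exists `|c|. Qed.

Lemma bnd_mfunD D f g :
  bnd_mfun D f -> bnd_mfun D g -> bnd_mfun D (fun t => f t + g t).
Proof.
move=> /bnd_mfunP[mf [C C0 fC]] /bnd_mfunP[mg [C' C'0 gC]].
apply/bnd_mfunP; split; first exact: measurable_funD.
exists (C + C'); first exact: addr_ge0.
by move=> t Dt; rewrite (le_trans (ler_normD _ _))// lerD ?fC ?gC.
Qed.

Lemma bnd_mfunM D f g :
  bnd_mfun D f -> bnd_mfun D g -> bnd_mfun D (fun t => f t * g t).
Proof.
move=> /bnd_mfunP[mf [C C0 fC]] /bnd_mfunP[mg [C' C'0 gC]].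
apply/bnd_mfunP; split; first exact: measurable_funM.
exists (C * C'); first exact: mulr_ge0.
by move=> t Dt; rewrite normrM ler_pM ?fC ?gC.
Qed.

Lemma bnd_mfun_sum D (I : Type) (s : seq I) (h : I -> T -> R) :
  (forall i, bnd_mfun D (h i)) -> bnd_mfun D (fun t => \sum_(i <- s) h i t).
Proof.
move=> hh; elim: s => [|i s IH].
  by under eq_fun do rewrite big_nil; exact: bnd_mfun_cst.
by under eq_fun do rewrite big_cons; exact: bnd_mfunD.
Qed.

Lemma bnd_mfun_comp {d'} {T' : measurableType d'} (E : set T') D
    (h : T' -> T) f :
  measurable D -> measurable_fun E h -> h @` E `<=` D ->
  bnd_mfun D f -> bnd_mfun E (f \o h).
Proof.
move=> mD mh hE /bnd_mfunP[mf [C C0 fC]]; apply/bnd_mfunP; split.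
  exact: (measurable_comp mD hE mf mh).
by exists C => // t Et; apply: fC; apply: hE; exists t.
Qed.

Lemma bnd_mfun_bool D (P : T -> bool) :
  measurable_fun D P -> bnd_mfun D (fun t => (P t)%:R : R).
Proof.
move=> mP; apply/bnd_mfunP; split; last first.
  by exists 1 => // t _; case: (P t); rewrite ?normr1 ?normr0.
have -> : (fun t => (P t)%:R : R) = (fun t => if P t then 1 else 0).
  by apply/funext => t; case: ifP.
by move=> mD; move: (mD); apply: measurable_fun_if.
Qed.

Lemma eq_bnd_mfun D f g : {in D, f =1 g} -> bnd_mfun D f -> bnd_mfun D g.
Proof.
move=> fg /bnd_mfunP[mf [C C0 fC]]; apply/bnd_mfunP; split.
  by apply: (eq_measurable_fun f).
by exists C => // t Dt; rewrite -fg ?inE//; exact: fC.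
Qed.

Lemma bounded_measurableD m p D (F G : T -> 'M[R]_(m, p)) :
  bounded_measurable D F -> bounded_measurable D G ->
  bounded_measurable D (fun t => F t + G t).
Proof.
move=> hF hG i j; under eq_fun do rewrite mxE; exact: bnd_mfunD.
Qed.

Lemma bounded_measurableM m p q D (F : T -> 'M[R]_(m, p))
    (G : T -> 'M[R]_(p, q)) :
  bounded_measurable D F -> bounded_measurable D G ->
  bounded_measurable D (fun t => F t *m G t).
Proof.
move=> hF hG i j; under eq_fun do rewrite mxE.
by apply: bnd_mfun_sum => k; exact: bnd_mfunM.
Qed.

Lemma bounded_measurableZ m p D f (F : T -> 'M[R]_(m, p)) :
  bnd_mfun D f -> bounded_measurable D F ->
  bounded_measurable D (fun t => f t *: F t).
Proof. by move=> hf hF i j; under eq_fun do rewrite mxE; exact: bnd_mfunM. Qed.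

Lemma bounded_measurable_trmx m p D (F : T -> 'M[R]_(m, p)) :
  bounded_measurable D F -> bounded_measurable D (fun t => (F t)^T).
Proof. by move=> hF i j; under eq_fun do rewrite mxE; exact: hF. Qed.

Lemma bounded_measurable_cst m p D (A : 'M[R]_(m, p)) :
  bounded_measurable D (fun=> A).
Proof. by move=> i j; exact: bnd_mfun_cst. Qed.

Lemma bounded_measurable_comp {d'} {T' : measurableType d'} (E : set T') m p D
    (h : T' -> T) (F : T -> 'M[R]_(m, p)) :
  measurable D -> measurable_fun E h -> h @` E `<=` D ->
  bounded_measurable D F -> bounded_measurable E (fun t => F (h t)).
Proof. by move=> mD mh hE hF i j; exact: bnd_mfun_comp (hF i j). Qed.

End BoundedMeasurableClosure.

(** * Fubini's theorem on the square under a product bound *)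

Section ScalarFubini.
Context {R : realType}.
Local Notation mu := (@lebesgue_measure R).
Variables (a b : R).
Local Notation D := (`[a, b]%classic : set R).

Lemma lebesgue_itvcc_fin : (mu D < +oo)%E.
Proof. by rewrite lebesgue_measure_itv/=; case: ifP => // _; rewrite -EFinB ltry. Qed.

Lemma bnd_mfun_integrable (f : R -> R) : bnd_mfun D f ->
  mu.-integrable D (EFin \o f).
Proof.
by move=> [mf bf]; apply: measurable_bounded_integrable => //; exact: lebesgue_itvcc_fin.
Qed.

Variables (F : R -> R -> R) (g h : R -> R).
Hypothesis mF : measurable_fun (D `*` D) (fun p : R * R => F p.1 p.2).
Hypothesis ig : mu.-integrable D (EFin \o g).
Hypothesis ih : mu.-integrable D (EFin \o h).
Hypothesis Fgh : forall s t, D s -> D t -> `|F s t| <= g s * h t.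

(** Extension of [F] by zero to the plane, where Fubini for the product measure applies. *)
Let G (p : R * R) : R := ((fun p => F p.1 p.2) \_ (D `*` D)) p.

Let mDD : measurable (D `*` D).
Proof. exact: measurableX. Qed.

Let mG : measurable_fun setT (EFin \o G).
Proof.
apply/measurable_EFinP; rewrite /G.
by apply/(measurable_restrictT _ _).1.
Qed.

Let GE s t : G (s, t) = (F s \_ D) t * \1_D s.
Proof.
rewrite /G !patchE indicE in_setX/=.
by case: (s \in D); case: (t \in D); rewrite /= ?mulr1 ?mulr0 ?mul0r.
Qed.

Let msec s : D s -> measurable_fun D (F s).
Proof.
move=> Ds; apply: (measurable_comp mDD _ mF (g := fun t => (s, t))) => //=.
  by move=> _ [t Dt <-].
exact/measurable_funTS/pair1_measurable.
Qed.

Let msec' t : D t -> measurable_fun D (F ^~ t).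
Proof.
move=> Dt; apply: (measurable_comp mDD _ mF (g := fun s => (s, t))) => //=.
  by move=> _ [s Ds <-].
exact/measurable_funTS/pair2_measurable.
Qed.

Let isec' t : D t -> mu.-integrable D (EFin \o F ^~ t).
Proof.
move=> Dt; have := @integrableZr _ _ _ mu _ (measurable_itv _) (h t) _ ig.
apply: le_integrable => //.
- by apply/measurable_EFinP; exact: msec'.
- by move=> s Ds /=; rewrite lee_fin; apply: le_trans (Fgh Ds Dt) _; rewrite ler_norm.
Qed.

Let isec s : D s -> mu.-integrable D (EFin \o F s).
Proof.
move=> Ds; have := @integrableZl _ _ _ mu _ (measurable_itv _) (g s) _ ih.
apply: le_integrable => //.
- by apply/measurable_EFinP; exact: msec.
- by move=> t Dt /=; rewrite lee_fin; apply: le_trans (Fgh Ds Dt) _; rewrite ler_norm.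
Qed.

Let iG : (mu \x mu)%E.-integrable setT (EFin \o G).
Proof.
apply/integrable12ltyP => //=.
have ih' : mu.-integrable setT (EFin \o (h \_ D)).
  by rewrite -restrict_EFin -integrable_mkcond//; exact: measurable_itv.
have ig' : mu.-integrable setT (EFin \o (g \_ D)).
  by rewrite -restrict_EFin -integrable_mkcond//; exact: measurable_itv.
have mg' := integrable_abse ig'; have mh' := integrable_abse ih'.
(* The hypotheses give no sign to [g] and [h], so the bound passes to |g| |h|, and the iterated
   integral of |G| is at most the product of two finite L^1 norms. *)
pose H := (\int[mu]_t `|(h \_ D) t|%:E)%E.
have H0 : (0 <= H)%E by exact: integral_ge0.
have Hfin : H \is a fin_num by exact: integrable_fin_num mh'.
apply: (@le_lt_trans _ _ (\int[mu]_s (`|(g \_ D) s|%:E * H))%E).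
  apply: ge0_le_integral => //.
  - by move=> s _; exact: integral_ge0.
  - apply: (@measurable_fun_fubini_tonelli_F _ _ (measurableTypeR R) (measurableTypeR R)
      R mu (fun p => (`|G p|)%:E)) => //.
    by apply/measurable_EFinP; apply: measurableT_comp => //; exact/measurable_EFinP.
  - by apply: emeasurable_funM => //; exact: measurable_int mg'.
  - move=> s _; rewrite -ge0_integralZl//; last first.
      exact: measurable_int mh'.
    apply: ge0_le_integral => //.
    + apply/measurable_EFinP; apply: measurableT_comp => //.
      apply/measurable_EFinP.
      have := measurableT_comp mG (pair1_measurable s); exact.
    + by apply: emeasurable_funM => //; exact: measurable_int mh'.
    + move=> t _; rewrite lee_fin GE -normrM !patchE indicE.
      case: ifPn; rewrite ?inE => Dt; last by rewrite mul0r normr0.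
      case: ifPn; rewrite ?inE => Ds; last by rewrite mulr0 normr0.
      by rewrite mulr1 (le_trans (Fgh Ds Dt))// ler_norm.
rewrite ge0_integralZr//; last exact: measurable_int mg'.
rewrite lte_mul_pinfty//.
- exact: integral_ge0.
- exact: integrable_fin_num mg'.
- by rewrite -ge0_fin_numE.
Qed.

Let innerE s : \int[mu]_t G (s, t) = (fun s => \int[mu]_(t in D) F s t) \_ D s.
Proof.
rewrite patchE; case: ifPn => Ds.
  rewrite [RHS]Rintegral_mkcond; apply: eq_Rintegral => t _.
  by rewrite GE indicE Ds mulr1.
rewrite (eq_Rintegral mu (g := cst 0)) ?Rintegral_cst ?mul0r// => t _.
by rewrite GE indicE (negbTE Ds) mulr0.
Qed.

Let outerE t : \int[mu]_s G (s, t) = (fun t => \int[mu]_(s in D) F s t) \_ D t.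
Proof.
rewrite patchE; case: ifPn => Dt.
  rewrite [RHS]Rintegral_mkcond; apply: eq_Rintegral => s _.
  by rewrite GE indicE !patchE Dt; case: ifPn; rewrite ?mulr1 ?mulr0.
rewrite (eq_Rintegral mu (g := cst 0)) ?Rintegral_cst ?mul0r// => s _.
by rewrite GE indicE patchE (negbTE Dt) mul0r.
Qed.

(** Real integrals are [fine] of extended ones. Removing the inner [fine] under the outer integral
    requires finiteness at every point, which the product bound provides everywhere. *)
Let finner s : (\int[mu]_t (G (s, t))%:E)%E \is a fin_num.
Proof.
have [Ds|nDs] := pselect (D s).
  apply: integrable_fin_num => //.
  have : mu.-integrable setT (EFin \o (F s \_ D)).
    by rewrite -restrict_EFin -integrable_mkcond//; exact: isec Ds.
  apply: eq_integrable => // t _ /=.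
  by rewrite GE indicE mem_set// mulr1.
rewrite (eq_integral (cst 0)) ?integral0// => t _.
by rewrite GE indicE memNset// mulr0.
Qed.

Let fouter t : (\int[mu]_s (G (s, t))%:E)%E \is a fin_num.
Proof.
have [Dt|nDt] := pselect (D t).
  apply: integrable_fin_num => //.
  have : mu.-integrable setT (EFin \o (F ^~ t \_ D)).
    by rewrite -restrict_EFin -integrable_mkcond//; exact: isec' Dt.
  apply: eq_integrable => // s _ /=.
  by rewrite GE indicE !patchE (mem_set Dt); case: ifPn; rewrite ?mulr1 ?mulr0.
rewrite (eq_integral (cst 0)) ?integral0// => s _.
by rewrite GE indicE patchE memNset// mul0r.
Qed.

Lemma Fubini_dominated :
  \int[mu]_(s in D) (\int[mu]_(t in D) F s t) =
  \int[mu]_(t in D) (\int[mu]_(s in D) F s t).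
Proof.
rewrite Rintegral_mkcond [RHS]Rintegral_mkcond.
rewrite (eq_Rintegral mu (g := fun s => \int[mu]_t G (s, t))); last by move=> s _; rewrite innerE.
rewrite [RHS](eq_Rintegral mu (g := fun t => \int[mu]_s G (s, t))); last by move=> t _; rewrite outerE.
rewrite /Rintegral; congr fine.
under eq_integral do rewrite fineK//.
under [RHS]eq_integral do rewrite fineK//.
exact: (Fubini iG).
Qed.

Lemma integrable_dominated :
  mu.-integrable D (EFin \o (fun s => \int[mu]_(t in D) F s t)).
Proof.
rewrite integrable_mkcond// restrict_EFin.
have := integrable_fubini_F iG; apply: eq_integrable => // s _.
by rewrite /= -innerE /fubini_F /Rintegral fineK.
Qed.

End ScalarFubini.

(** * Integrals of matrix-valued functions *)

Section MatrixIntegral.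
Context {R : realType}.
Local Notation mu := (@lebesgue_measure R).
Variables (a b : R).
Local Notation D := (`[a, b]%classic : set R).

Lemma measurable_itvcc : measurable D.
Proof. exact: measurable_itv. Qed.

Lemma measurable_itvcc_prod : measurable (D `*` D).
Proof. by apply: measurableX; exact: measurable_itv. Qed.

Lemma measurable_fun_fst_itvcc (f : R -> R) : measurable_fun D f ->
  measurable_fun (D `*` D) (fun p : R * R => f p.1).
Proof.
move=> mf; apply: (measurable_comp measurable_itvcc _ mf).
- by move=> _ [[s t] [Ds Dt] <-].
- by apply: measurable_funTS; exact: measurable_fst.
Qed.

Lemma measurable_fun_snd_itvcc (f : R -> R) : measurable_fun D f ->
  measurable_fun (D `*` D) (fun p : R * R => f p.2).
Proof.
move=> mf; apply: (measurable_comp measurable_itvcc _ mf).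
- by move=> _ [[s t] [Ds Dt] <-].
- by apply: measurable_funTS; exact: measurable_snd.
Qed.

(** Tonelli's theorem gives the measurability of a parameter integral for nonnegative integrands. So
    [F] is shifted by its bound [C], and the finite number C mu(D) is subtracted afterwards. The
    parameter space is arbitrary because [bounded_kernel_mxint] takes it to be the plane. *)
Lemma bnd_mfun_Rintegral {d} {T : measurableType d} (E : set T)
    (F : T * R -> R) : measurable E -> bnd_mfun (E `*` D) F ->
  bnd_mfun E (fun x => \int[mu]_(z in D) F (x, z)).
Proof.
move=> mE /bnd_mfunP[mF [C C0 FC]].
have mED : measurable (E `*` D) by apply: measurableX => //; exact: measurable_itv.
have sec x : E x -> bnd_mfun D (fun z => F (x, z)).
  move=> Ex; apply/bnd_mfunP; split; last by exists C => // z Dz; exact: FC.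
  apply: (measurable_comp mED _ mF (g := pair x)).
    by move=> _ [t Dt <-].
  exact/measurable_funTS/pair1_measurable.
pose G (p : T * R) : R := ((fun p => F p + C) \_ (E `*` D)) p.
have mG : measurable_fun setT (EFin \o G).
  apply/measurable_EFinP/(measurable_restrictT _ _).1 => //.
  by apply: measurable_funD => //; exact: measurable_cst.
have G0 p : (0 <= (G p)%:E)%E.
  rewrite lee_fin /G patchE; case: ifPn => //; rewrite inE => Ep.
  by rewrite -lerBlDr sub0r; have := FC p Ep; rewrite ler_norml => /andP[].
apply/bnd_mfunP; split; last first.
  exists (C * fine (mu D)).
    by rewrite mulr_ge0// fine_ge0.
  move=> x Ex; have iF := bnd_mfun_integrable (sec x Ex).
  apply: le_trans (le_normr_Rintegral _ _) _ => //.
  rewrite -Rintegral_cst//; apply: le_Rintegral => //.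
  - exact: integrable_norm.
  - exact/bnd_mfun_integrable/bnd_mfun_cst.
  - by move=> z Dz; exact: FC.
apply: (eq_measurable_fun (fun x => fine (\int[mu]_z (G (x, z))%:E)%E - C * fine (mu D))).
  move=> x; rewrite inE => Ex.
  have -> : fine (\int[mu]_z (G (x, z))%:E)%E = \int[mu]_(z in D) (F (x, z) + C).
    rewrite Rintegral_mkcond /Rintegral; congr fine; apply: eq_integral => z _.
    rewrite /G !patchE in_setX/= mem_set//=.
  rewrite RintegralD//.
  - by rewrite Rintegral_cst// addrK.
  - exact/bnd_mfun_integrable/sec.
  - exact/bnd_mfun_integrable/bnd_mfun_cst.
apply: measurable_funB; last exact: measurable_cst.
apply: measurableT_comp => //.
apply: measurable_funTS.
exact: (@measurable_fun_fubini_tonelli_F _ _ T (measurableTypeR R) R mu (EFin \o G)).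
Qed.

Lemma bounded_measurable_mxint {d} {T : measurableType d} (E : set T) m p
    (F : T * R -> 'M[R]_(m, p)) : measurable E ->
  bounded_measurable (E `*` D) F ->
  bounded_measurable E (fun x => mxint a b (fun z => F (x, z))).
Proof.
move=> mE hF i j; under eq_fun do rewrite mxE.
exact: (bnd_mfun_Rintegral mE (hF i j)).
Qed.

Definition mxintegrable m p (F : R -> 'M[R]_(m, p)) : Prop :=
  forall i j, mu.-integrable D (EFin \o (fun t => F t i j)).

Lemma mxintE m p (c d : R) (F : R -> 'M[R]_(m, p)) i j :
  mxint c d F i j = \int[mu]_(t in `[c, d]) F t i j.
Proof. by rewrite mxE. Qed.

Lemma mxint_mxintE m p (L : R -> R -> 'M[R]_(m, p)) i j :
  mxint a b (fun s => mxint a b (L s)) i j =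
  \int[mu]_(s in D) \int[mu]_(t in D) L s t i j.
Proof. by rewrite mxintE; apply: eq_Rintegral => s _; rewrite mxintE. Qed.

Lemma eq_mxint m p (F G : R -> 'M[R]_(m, p)) :
  (forall t, D t -> F t = G t) -> mxint a b F = mxint a b G.
Proof.
move=> FG; apply/matrixP => i j; rewrite !mxE; apply: eq_Rintegral => t.
by rewrite inE => /FG ->.
Qed.

Lemma eq_integrable_itvcc (f g : R -> R) :
  (forall t, D t -> f t = g t) -> mu.-integrable D (EFin \o f) ->
  mu.-integrable D (EFin \o g).
Proof.
move=> fg; apply: eq_integrable => // t; rewrite inE => Dt.
by rewrite /= fg.
Qed.

Lemma bounded_mxintegrable m p (F : R -> 'M[R]_(m, p)) :
  bounded_measurable D F -> mxintegrable F.
Proof. by move=> hF i j; exact/bnd_mfun_integrable/hF. Qed.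

Lemma mxintegrableD m p (F G : R -> 'M[R]_(m, p)) :
  mxintegrable F -> mxintegrable G -> mxintegrable (fun t => F t + G t).
Proof.
move=> iF iG i j.
apply: (eq_integrable_itvcc (f := fun t => F t i j + G t i j)).
  by move=> t _; rewrite mxE.
exact: (@integrableD _ _ _ mu _ (measurable_itv _) _ _ (iF i j) (iG i j)).
Qed.

Lemma Rintegrable_sum n (h : 'I_n -> R -> R) :
  (forall k, mu.-integrable D (EFin \o h k)) ->
  mu.-integrable D (EFin \o (fun t => \sum_k h k t)).
Proof.
move=> ih; have := @integrable_sum _ _ _ mu _ (measurable_itv _) _ (index_enum 'I_n) xpredT _
  (fun k _ => ih k).
apply: eq_integrable => // t _ /=.
by rewrite sumEFin.
Qed.

Lemma Rintegral_sum n (h : 'I_n -> R -> R) :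
  (forall k, mu.-integrable D (EFin \o h k)) ->
  \int[mu]_(t in D) (\sum_k h k t) = \sum_k \int[mu]_(t in D) h k t.
Proof.
elim: n h => [|n IH] h ih.
  by under eq_Rintegral do rewrite big_ord0; rewrite Rintegral_cst// mul0r big_ord0.
under eq_Rintegral do rewrite big_ord_recl.
rewrite big_ord_recl RintegralD//; first by rewrite IH.
by apply: Rintegrable_sum => k; exact: ih.
Qed.

Lemma mxintegrableM m p q (F : R -> 'M[R]_(m, p)) (G : R -> 'M[R]_(p, q)) :
  bounded_measurable D F -> mxintegrable G -> mxintegrable (fun t => F t *m G t).
Proof.
move=> hF iG i j.
apply: (eq_integrable_itvcc (f := fun t => \sum_k F t i k * G t k j)).
  by move=> t _; rewrite mxE.
apply: Rintegrable_sum => k.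
have [mF bF] := hF i k.
exact: (@integrableMr _ _ _ mu _ (measurable_itv _) _ _ mF bF (iG k j)).
Qed.

Lemma mxintegrableMr m p q (F : R -> 'M[R]_(m, p)) (G : R -> 'M[R]_(p, q)) :
  mxintegrable F -> bounded_measurable D G -> mxintegrable (fun t => F t *m G t).
Proof.
move=> iF hG i j.
apply: (eq_integrable_itvcc (f := fun t => \sum_k F t i k * G t k j)).
  by move=> t _; rewrite mxE.
apply: Rintegrable_sum => k.
have [mG bG] := hG k j.
exact: (@integrableMl _ _ _ mu _ (measurable_itv _) _ _ (iF i k) mG bG).
Qed.

Lemma mxintegrable_trmx m p (F : R -> 'M[R]_(m, p)) :
  mxintegrable F -> mxintegrable (fun t => (F t)^T).
Proof. by move=> iF i j; apply: eq_integrable_itvcc (iF j i) => t _; rewrite mxE. Qed.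

Lemma mxintD m p (F G : R -> 'M[R]_(m, p)) :
  mxintegrable F -> mxintegrable G ->
  mxint a b (fun t => F t + G t) = mxint a b F + mxint a b G.
Proof.
move=> iF iG; apply/matrixP => i j; rewrite !mxE -RintegralD//.
by under eq_Rintegral do rewrite mxE.
Qed.

Lemma trmx_mxint m p (F : R -> 'M[R]_(m, p)) :
  (mxint a b F)^T = mxint a b (fun t => (F t)^T).
Proof.
by apply/matrixP => i j; rewrite !mxE; under [RHS]eq_Rintegral do rewrite mxE.
Qed.

Lemma mulmx_mxint m p q (A : 'M[R]_(m, p)) (F : R -> 'M[R]_(p, q)) :
  mxintegrable F -> A *m mxint a b F = mxint a b (fun t => A *m F t).
Proof.
move=> iF; apply/matrixP => i j; rewrite mxE [RHS]mxE.
under [RHS]eq_Rintegral do rewrite mxE.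
rewrite Rintegral_sum => [|k].
  by apply: eq_bigr => k _; rewrite mxE RintegralZl.
exact: (@integrableZl _ _ _ mu _ (measurable_itv _) _ _ (iF k j)).
Qed.

Lemma mxint_mulmx m p q (F : R -> 'M[R]_(m, p)) (A : 'M[R]_(p, q)) :
  mxintegrable F -> mxint a b F *m A = mxint a b (fun t => F t *m A).
Proof.
move=> iF; rewrite -[LHS]trmxK trmx_mul trmx_mxint mulmx_mxint; last first.
  exact: mxintegrable_trmx.
by rewrite trmx_mxint; apply: eq_mxint => t _; rewrite trmx_mul !trmxK.
Qed.

Lemma bounded_measurable_bound {d} {T : measurableType d} (E : set T) m p
    (F : T -> 'M[R]_(m, p)) : bounded_measurable E F ->
  exists2 C, 0 <= C & forall t i j, E t -> `|F t i j| <= C.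
Proof.
move=> hF.
have {}hF i j : exists C, 0 <= C /\ forall t, E t -> `|F t i j| <= C.
  by have /bnd_mfunP[_ [C C0 hC]] := hF i j; exists C.
have {}hF i : exists c : 'I_p -> R,
    forall j, 0 <= c j /\ forall t, E t -> `|F t i j| <= c j.
  by have [c hc] := choice (hF i); exists c.
have {hF} [c hc] := choice hF.
exists (\sum_i \sum_j c i j).
  by apply: sumr_ge0 => i _; apply: sumr_ge0 => j _; have [] := hc i j.
move=> t i j Et; have [_ hij] := hc i j; apply: le_trans (hij t Et) _.
rewrite (bigD1 i)//= (bigD1 j)//= -addrA lerDl addr_ge0//.
  by apply: sumr_ge0 => j' _; have [] := hc i j'.
by apply: sumr_ge0 => i' _; apply: sumr_ge0 => j' _; have [] := hc i' j'.
Qed.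

(** Each entry of the integrand is at most the sum of |A s i k| over k times the sum of C |f t l j|
    over l, with [C] a common bound for the entries of [K]. This is the product form that
    [Fubini_dominated] and [integrable_dominated] ask for. *)
Lemma mxint_exchange m p q r (A : R -> 'M[R]_(m, p)) (K : R -> R -> 'M[R]_(p, q))
    (f : R -> 'M[R]_(q, r)) :
  mxintegrable A -> bounded_measurable (D `*` D) (fun z : R * R => K z.1 z.2) ->
  mxintegrable f ->
  mxint a b (fun s => mxint a b (fun t => A s *m K s t *m f t)) =
  mxint a b (fun t => mxint a b (fun s => A s *m K s t *m f t)) /\
  mxintegrable (fun s => mxint a b (fun t => A s *m K s t *m f t)).
Proof.
move=> iA hK iF; have [C C0 KC] := bounded_measurable_bound hK.
pose H i j s t := (A s *m K s t *m f t) i j.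
pose g i s := \sum_k `|A s i k|; pose h j t := \sum_l C * `|f t l j|.
have ig i : mu.-integrable D (EFin \o g i).
  by apply: Rintegrable_sum => k; exact: integrable_norm.
have ih j : mu.-integrable D (EFin \o h j).
  apply: Rintegrable_sum => k.
  exact: (@integrableZl _ _ _ mu _ (measurable_itv _) C _ (integrable_norm (iF k j))).
have mH i j : measurable_fun (D `*` D) (fun z : R * R => H i j z.1 z.2).
  apply: (eq_measurable_fun (fun z : R * R =>
      \sum_l (\sum_k A z.1 i k * K z.1 z.2 k l) * f z.2 l j)).
    by move=> z _; rewrite /H mxE; apply: eq_bigr => l _; rewrite mxE.
  apply: measurable_sum => l; apply: measurable_funM; last first.
    apply: (measurable_fun_snd_itvcc (f := fun t => f t l j)).
    by have /measurable_int/measurable_EFinP := iF l j.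
  apply: measurable_sum => k; apply: measurable_funM; last by have [] := hK k l.
  apply: (measurable_fun_fst_itvcc (f := fun s => A s i k)).
  by have /measurable_int/measurable_EFinP := iA i k.
have Hgh i j s t : D s -> D t -> `|H i j s t| <= g i s * h j t.
  move=> Ds Dt; rewrite /H mxE (le_trans (ler_norm_sum _ _ _))//.
  rewrite mulr_sumr ler_sum// => l _; rewrite normrM mulrA ler_wpM2r//.
  rewrite mxE (le_trans (ler_norm_sum _ _ _))// mulr_suml ler_sum// => k _.
  by rewrite normrM ler_wpM2l//; exact: (KC (s, t)).
split.
  apply/matrixP => i j.
  pose L s t := A s *m K s t *m f t.
  apply: etrans (mxint_mxintE L i j) _.
  apply: etrans _ (esym (mxint_mxintE (fun t s => L s t) i j)).
  exact: (Fubini_dominated (mH i j) (ig i) (ih j) (Hgh i j)).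
move=> i j; apply: (eq_integrable_itvcc (f := fun s => \int[mu]_(t in D) H i j s t)).
  by move=> s _; rewrite mxE.
exact: (integrable_dominated (mH i j) (ig i) (ih j) (Hgh i j)).
Qed.

Lemma bounded_measurable_pair1 m p (K : R -> R -> 'M[R]_(m, p)) s :
  bounded_measurable (D `*` D) (fun z : R * R => K z.1 z.2) -> D s ->
  bounded_measurable D (K s).
Proof.
move=> hK Ds.
apply: (bounded_measurable_comp (h := pair s) measurable_itvcc_prod _ _ hK).
  exact/measurable_funTS/pair1_measurable.
by move=> _ [t Dt <-].
Qed.

Lemma bounded_measurable_pair2 m p (K : R -> R -> 'M[R]_(m, p)) t :
  bounded_measurable (D `*` D) (fun z : R * R => K z.1 z.2) -> D t ->
  bounded_measurable D (K ^~ t).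
Proof.
move=> hK Dt.
apply: (bounded_measurable_comp (h := pair^~ t) measurable_itvcc_prod _ _ hK).
  exact/measurable_funTS/pair2_measurable.
by move=> _ [s Ds <-].
Qed.

(** Working form of Fubini: a row function, a kernel and a column function compose associatively.
    Both outer factors may be unbounded, which allows [x_ss] on either side. *)
Lemma mxint_assoc m p q r (A : R -> 'M[R]_(m, p)) (K : R -> R -> 'M[R]_(p, q))
    (f : R -> 'M[R]_(q, r)) :
  mxintegrable A -> bounded_measurable (D `*` D) (fun z : R * R => K z.1 z.2) ->
  mxintegrable f ->
  mxint a b (fun s => A s *m mxint a b (fun t => K s t *m f t)) =
  mxint a b (fun t => mxint a b (fun s => A s *m K s t) *m f t).
Proof.
move=> iA hK iF; transitivity
  (mxint a b (fun s => mxint a b (fun t => A s *m K s t *m f t))).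
  apply: eq_mxint => s Ds; rewrite mulmx_mxint; last first.
    by apply: mxintegrableM => //; exact: bounded_measurable_pair1.
  by apply: eq_mxint => t _; rewrite mulmxA.
have [-> _] := mxint_exchange iA hK iF.
apply: eq_mxint => t Dt; rewrite mxint_mulmx//.
by apply: mxintegrableMr => //; exact: (bounded_measurable_pair2 hK).
Qed.

Lemma mxintegrable_kernel p q r (K : R -> R -> 'M[R]_(p, q))
    (f : R -> 'M[R]_(q, r)) :
  bounded_measurable (D `*` D) (fun z : R * R => K z.1 z.2) -> mxintegrable f ->
  mxintegrable (fun s => mxint a b (fun t => K s t *m f t)).
Proof.
move=> hK iF.
have i1 : mxintegrable (fun=> 1%:M : 'M[R]_p).
  exact/bounded_mxintegrable/bounded_measurable_cst.
have [_] := mxint_exchange i1 hK iF.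
by under eq_fun do under eq_fun do rewrite mul1mx.
Qed.

End MatrixIntegral.

(** * Bounded kernels *)

Section BoundedKernels.
Context {R : realType}.
Local Notation mu := (@lebesgue_measure R).
Variables (a b : R).
Local Notation D := (`[a, b]%classic : set R).

Definition bounded_kernel m p (K : R -> R -> 'M[R]_(m, p)) : Prop :=
  bounded_measurable (D `*` D) (fun z : R * R => K z.1 z.2).

Lemma bounded_kernelD m p (K L : R -> R -> 'M[R]_(m, p)) :
  bounded_kernel K -> bounded_kernel L ->
  bounded_kernel (fun s t => K s t + L s t).
Proof. exact: bounded_measurableD. Qed.

Lemma bounded_kernelM m p q (K : R -> R -> 'M[R]_(m, p))
    (L : R -> R -> 'M[R]_(p, q)) :
  bounded_kernel K -> bounded_kernel L ->
  bounded_kernel (fun s t => K s t *m L s t).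
Proof. exact: bounded_measurableM. Qed.

Lemma bounded_kernelZ m p (c : R -> R -> R) (K : R -> R -> 'M[R]_(m, p)) :
  bnd_mfun (D `*` D) (fun z : R * R => c z.1 z.2) -> bounded_kernel K ->
  bounded_kernel (fun s t => c s t *: K s t).
Proof. exact: bounded_measurableZ. Qed.

Lemma bounded_kernel_cst m p (A : 'M[R]_(m, p)) : bounded_kernel (fun _ _ => A).
Proof. exact: bounded_measurable_cst. Qed.

Lemma bounded_kernel_trmx m p (K : R -> R -> 'M[R]_(m, p)) :
  bounded_kernel K -> bounded_kernel (fun s t => (K s t)^T).
Proof. exact: bounded_measurable_trmx. Qed.

Lemma bounded_kernel_swap m p (K : R -> R -> 'M[R]_(m, p)) :
  bounded_kernel K -> bounded_kernel (fun s t => K t s).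
Proof.
move=> hK.
apply: (bounded_measurable_comp (h := fun z : R * R => (z.2, z.1))
  (measurable_itvcc_prod a b) _ _ hK).
  apply: measurable_funTS; apply: measurable_fun_pair.
    exact: measurable_snd.
  exact: measurable_fst.
by move=> _ [[s t] [Ds Dt] <-].
Qed.

Lemma bounded_kernel_fst m p (F : R -> 'M[R]_(m, p)) :
  bounded_measurable D F -> bounded_kernel (fun s _ => F s).
Proof.
move=> hF.
apply: (bounded_measurable_comp (h := fst) (measurable_itvcc a b) _ _ hF).
  by apply: measurable_funTS; exact: measurable_fst.
by move=> _ [[s t] [Ds Dt] <-].
Qed.

Lemma bounded_kernel_mxint m p q (K : R -> R -> 'M[R]_(m, p))
    (L : R -> R -> 'M[R]_(p, q)) :
  bounded_kernel K -> bounded_kernel L ->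
  bounded_kernel (fun s t => mxint a b (fun z => K s z *m L z t)).
Proof.
move=> hK hL.
apply: (bounded_measurable_mxint (b := b)
  (F := fun y : (R * R) * R => K y.1.1 y.2 *m L y.2 y.1.2)).
  exact: measurable_itvcc_prod.
apply: bounded_measurableM.
- apply: (bounded_measurable_comp (h := fun y : (R * R) * R => (y.1.1, y.2))
    (measurable_itvcc_prod a b) _ _ hK).
    apply: measurable_funTS; apply: measurable_fun_pair.
      by apply: measurableT_comp; exact: measurable_fst.
    exact: measurable_snd.
  by move=> _ [[[s t] z] [[Ds Dt] Dz] <-].
- apply: (bounded_measurable_comp (h := fun y : (R * R) * R => (y.2, y.1.2))
    (measurable_itvcc_prod a b) _ _ hL).
    apply: measurable_funTS; apply: measurable_fun_pair.
      exact: measurable_snd.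
    by apply: measurableT_comp; [exact: measurable_snd|exact: measurable_fst].
  by move=> _ [[[s t] z] [[Ds Dt] Dz] <-].
Qed.

Lemma bounded_kernel_mxintegrable1 m p (K : R -> R -> 'M[R]_(m, p)) s :
  bounded_kernel K -> D s -> mxintegrable a b (K s).
Proof. by move=> hK Ds; exact/bounded_mxintegrable/bounded_measurable_pair1. Qed.

Lemma bounded_kernel_mxintegrable2 m p (K : R -> R -> 'M[R]_(m, p)) t :
  bounded_kernel K -> D t -> mxintegrable a b (K ^~ t).
Proof.
by move=> hK Dt; apply/bounded_mxintegrable/(bounded_measurable_pair2 hK).
Qed.

Lemma bnd_mfun_le :
  bnd_mfun (D `*` D) (fun z : R * R => (z.1 <= z.2)%R%:R : R).
Proof.
apply: bnd_mfun_bool; apply: measurable_funTS.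
by apply: measurable_fun_ler; [exact: measurable_fst|exact: measurable_snd].
Qed.

Lemma bnd_mfun_ge :
  bnd_mfun (D `*` D) (fun z : R * R => (z.2 <= z.1)%R%:R : R).
Proof.
apply: bnd_mfun_bool; apply: measurable_funTS.
by apply: measurable_fun_ler; [exact: measurable_snd|exact: measurable_fst].
Qed.

Lemma bnd_mfun_itvcc_id : bnd_mfun D id.
Proof.
apply/bnd_mfunP; split; first exact: measurable_id.
exists (`|a| + `|b|); first exact: addr_ge0.
move=> t /=; rewrite in_itv/= => /andP[at_ tb].
have := ler_norm (- a); have := ler_norm b.
have := normr_ge0 a; have := normr_ge0 b; rewrite normrN ler_norml.
by move=> *; apply/andP; split; lra.
Qed.

Lemma bnd_mfun_fst (f : R -> R) : bnd_mfun D f ->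
  bnd_mfun (D `*` D) (fun z : R * R => f z.1).
Proof.
move=> hf; apply: (bnd_mfun_comp (measurable_itvcc a b) _ _ hf).
  by apply: measurable_funTS; exact: measurable_fst.
by move=> _ [[s t] [Ds Dt] <-].
Qed.

Lemma bnd_mfun_snd (f : R -> R) : bnd_mfun D f ->
  bnd_mfun (D `*` D) (fun z : R * R => f z.2).
Proof.
move=> hf; apply: (bnd_mfun_comp (measurable_itvcc a b) _ _ hf).
  by apply: measurable_funTS; exact: measurable_snd.
by move=> _ [[s t] [Ds Dt] <-].
Qed.

(** At t - e this is the kernel of Taylor's remainder; cutting off at 0 lets the remainder range
    over all of [a, b]. *)
Definition pospart (u : R) : R := Num.max 0 u.

Lemma bnd_mfun_pospart :
  bnd_mfun (D `*` D) (fun z : R * R => pospart (z.1 - z.2)).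
Proof.
apply/bnd_mfunP; split.
  apply: measurable_maxr; first exact: measurable_cst.
  apply: measurable_funTS; apply: measurable_funB.
    exact: measurable_fst.
  exact: measurable_snd.
exists `|b - a| => // -[s t] [/=]; rewrite !in_itv/= => /andP[as_ sb] /andP[at_ tb].
rewrite /pospart ger0_norm ?le_max ?lexx//.
by rewrite ge_max normr_ge0 (le_trans _ (ler_norm _))//; lra.
Qed.

(** Moves the variable bounds into an indicator, so that kernels compose over one fixed interval.
    For d < c both sides are 0. *)
Lemma mxint_itvcc m p (c d : R) (F : R -> 'M[R]_(m, p)) : a <= c -> d <= b ->
  mxint c d F = mxint a b (fun t => (c <= t <= d)%R%:R *: F t).
Proof.
move=> ac db; apply/matrixP => i j; rewrite !mxE.
rewrite Rintegral_mkcond [RHS]Rintegral_mkcond; apply: eq_Rintegral => t _.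
rewrite !patchE !mem_setE !in_itv/= mxE.
have [/andP[ct td]|_] := boolP (c <= t <= d).
  by rewrite (le_trans ac ct) (le_trans td db) mul1r.
by rewrite mul0r; case: ifP.
Qed.

End BoundedKernels.

(** * The kernel of K^* P K *)

Section KernelOfP.
Context {R : realType} {n : nat}.
Local Notation mu := (@lebesgue_measure R).
Variables (a b : R).
Local Notation D := (`[a, b]%classic : set R).
Variables (M : R -> 'M[R]_n) (N1 N2 : R -> R -> 'M[R]_n).
Hypothesis hM : bounded_measurable D M.
Hypothesis hN1 : bounded_kernel a b N1.
Hypothesis hN2 : bounded_kernel a b N2.

(* The two integral terms of [opP] overlap only on the null diagonal, so they
   may be merged into one kernel, pointwise and without a.e. argument, by
   counting the diagonal twice. *)
Definition lowker (s t : R) : 'M[R]_n := (t <= s)%R%:R *: N1 s t.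
Definition uppker (s t : R) : 'M[R]_n := (s <= t)%R%:R *: N2 s t.
Definition opker (s t : R) : 'M[R]_n := lowker s t + uppker s t.

Lemma bounded_lowker : bounded_kernel a b lowker.
Proof. exact: bounded_kernelZ (bnd_mfun_ge a b) hN1. Qed.

Lemma bounded_uppker : bounded_kernel a b uppker.
Proof. exact: bounded_kernelZ (bnd_mfun_le a b) hN2. Qed.

Lemma bounded_opker : bounded_kernel a b opker.
Proof. exact: bounded_kernelD bounded_lowker bounded_uppker. Qed.

Lemma mxint_lower m (F : R -> 'M[R]_(n, m)) s : D s ->
  mxint a s (fun t => N1 s t *m F t) = mxint a b (fun t => lowker s t *m F t).
Proof.
rewrite /= in_itv/= => /andP[as_ sb]; rewrite (mxint_itvcc _ (lexx a) sb).
apply: eq_mxint => t; rewrite /= in_itv/= => /andP[-> _].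
by rewrite scalemxAl.
Qed.

Lemma mxint_upper m (F : R -> 'M[R]_(n, m)) s : D s ->
  mxint s b (fun t => N2 s t *m F t) = mxint a b (fun t => uppker s t *m F t).
Proof.
rewrite /= in_itv/= => /andP[as_ sb]; rewrite (mxint_itvcc _ as_ (lexx b)).
apply: eq_mxint => t; rewrite /= in_itv/= => /andP[_ ->].
by rewrite andbT scalemxAl.
Qed.

Lemma mxint_opker m (F : R -> 'M[R]_(n, m)) s : mxintegrable a b F -> D s ->
  mxint a s (fun t => N1 s t *m F t) + mxint s b (fun t => N2 s t *m F t) =
  mxint a b (fun t => opker s t *m F t).
Proof.
move=> iF Ds; rewrite mxint_lower// mxint_upper// -mxintD.
- by apply: eq_mxint => t _; rewrite mulmxDl.
- by apply: mxintegrableM => //; exact: bounded_measurable_pair1 bounded_lowker Ds.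
- by apply: mxintegrableM => //; exact: bounded_measurable_pair1 bounded_uppker Ds.
Qed.

Lemma opP_opker (x : R -> 'cV[R]_n) s : mxintegrable a b x -> D s ->
  opP a b M N1 N2 x s = M s *m x s + mxint a b (fun t => opker s t *m x t).
Proof. by move=> ix Ds; rewrite /opP -addrA mxint_opker. Qed.

Section Composition.
Variable K : R -> R -> 'M[R]_n.
Hypothesis hK : bounded_kernel a b K.

(** [compP] is the kernel of P K and [sandwichP] that of K^* P K. Multiplication by [M] has no
    kernel of its own, but it acquires one once composed with [K]. *)
Definition compP (s e : R) : 'M[R]_n :=
  M s *m K s e + mxint a b (fun t => opker s t *m K t e).

Definition sandwichP (s e : R) : 'M[R]_n :=
  mxint a b (fun z => (K z s)^T *m compP z e).

Lemma bounded_compP : bounded_kernel a b compP.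
Proof.
apply: bounded_kernelD.
  by apply: bounded_kernelM => //; exact: bounded_kernel_fst.
by apply: bounded_kernel_mxint => //; exact: bounded_opker.
Qed.

Lemma bounded_trmx_kernel : bounded_kernel a b (fun s z => (K z s)^T).
Proof. exact: (bounded_kernel_swap (bounded_kernel_trmx hK)). Qed.

Variable f : R -> 'cV[R]_n.
Hypothesis hf : mxintegrable a b f.

Let x s := mxint a b (fun e => K s e *m f e).

Lemma opP_compP s : D s ->
  opP a b M N1 N2 x s = mxint a b (fun e => compP s e *m f e).
Proof.
move=> Ds; rewrite opP_opker//; last exact: mxintegrable_kernel.
have iop : mxintegrable a b (opker s).
  exact: (bounded_kernel_mxintegrable1 bounded_opker).
rewrite mxint_assoc// /x mulmx_mxint; last first.
  by apply: mxintegrableM => //; exact: bounded_measurable_pair1.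
rewrite -mxintD.
- by apply: eq_mxint => e _; rewrite mulmxDl mulmxA.
- apply: (mxintegrableM (F := cst (M s))); first exact: bounded_measurable_cst.
  by apply: mxintegrableM => //; exact: bounded_measurable_pair1.
- apply: mxintegrableM => //.
  apply: (bounded_measurable_pair1 (K := fun s e => mxint a b (fun t => opker s t *m K t e))) Ds.
  by apply: bounded_kernel_mxint => //; exact: bounded_opker.
Qed.

Lemma inner_sandwichP :
  mxint a b (fun s => (x s)^T *m opP a b M N1 N2 x s) =
  mxint a b (fun s => (f s)^T *m mxint a b (fun e => sandwichP s e *m f e)).
Proof.
pose y s := mxint a b (fun e => compP s e *m f e).
have iy : mxintegrable a b y by exact: mxintegrable_kernel bounded_compP _.
transitivity (mxint a b (fun s => mxint a b (fun e => (f e)^T *m (K s e)^T) *m y s)).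
  apply: eq_mxint => s Ds; rewrite opP_compP// /x trmx_mxint; congr (_ *m _).
  by apply: eq_mxint => e _; rewrite trmx_mul.
(* The first exchange moves K^* onto [y], that is onto P K f; the second, below, merges K^* with the
   kernel of P K. *)
rewrite -(mxint_assoc (mxintegrable_trmx hf) bounded_trmx_kernel iy).
apply: eq_mxint => s Ds; congr (_ *m _).
rewrite (mxint_assoc (A := fun z => (K z s)^T) _ bounded_compP hf)//.
exact: bounded_kernel_mxintegrable1 bounded_trmx_kernel Ds.
Qed.

End Composition.
End KernelOfP.

Lemma mxint_itvcc_split {R : realType} m p (a b c : R) (F : R -> 'M[R]_(m, p)) :
  a <= c -> c <= b -> mxintegrable a b F ->
  mxint a c F + mxint c b F = mxint a b F.
Proof.
move=> ac cb iF; apply/matrixP => i j; rewrite !mxE.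
rewrite -[X in _ + X](Rintegral_itv_obnd_cbnd (r := c)); last first.
  apply: integrableS (iF i j) => // t /=.
  by rewrite !in_itv/= => /andP[/ltW ct ->]; rewrite (le_trans ac).
by rewrite -(Rintegral_itvB (iF i j)) ?bnd_simp// addrC subrK.
Qed.

(** * Identification of the kernel of K^* P K with [T_1] and [T_2] *)

Section SandwichKernel.
Context {R : realType} {n : nat}.
Local Notation mu := (@lebesgue_measure R).
Variables (a b : R) (B : 'M[R]_(n + n, (n + n) + (n + n))).
Local Notation D := (`[a, b]%classic : set R).
Local Notation Ba := (B_a a b B).

Lemma B_45E s :
  B_45 a b B s = row_mx (ulsubmx (B_3 a b B) + (s - a) *: dlsubmx (B_3 a b B))
                        (ursubmx (B_3 a b B) + (s - a) *: drsubmx (B_3 a b B)).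
Proof.
rewrite /B_45 -[B_3 a b B in LHS]submxK mul_row_block !mul1mx.
by rewrite !mul_scalar_mx.
Qed.

Lemma bounded_B_a : bounded_kernel a b Ba.
Proof.
have hs c : bnd_mfun D (fun s : R => s - c).
  by apply: bnd_mfunD; [exact: bnd_mfun_itvcc_id|exact: bnd_mfun_cst].
have haff (A A' : 'M[R]_n) : bounded_kernel a b (fun s _ => A + (s - a) *: A').
  apply: bounded_kernelD; first exact: bounded_kernel_cst.
  apply: bounded_kernelZ; last exact: bounded_kernel_cst.
  exact: bnd_mfun_fst (hs a).
apply: bounded_kernelD.
  apply: bounded_kernelZ.
    apply: (bnd_mfun_snd (f := fun t => b - t)).
    apply: (eq_bnd_mfun (f := fun t : R => (- 1) * (t - b))).
      by move=> t _; ring.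
    by apply: bnd_mfunM => //; exact: bnd_mfun_cst.
  by rewrite /B_4; under eq_fun do under eq_fun do rewrite B_45E row_mxKl; exact: haff.
by rewrite /B_5; under eq_fun do under eq_fun do rewrite B_45E row_mxKr; exact: haff.
Qed.

Lemma bounded_pospart_mx m :
  bounded_kernel a b (fun s t => (pospart (s - t))%:M : 'M[R]_m).
Proof.
have h1 := bounded_kernelZ (c := fun s t => pospart (s - t))
  (bnd_mfun_pospart a b) (bounded_kernel_cst a b (1%:M : 'M[R]_m)).
rewrite (_ : (fun _ _ => _) = (fun s t => pospart (s - t) *: 1%:M))//.
by apply/funext => s; apply/funext => t; rewrite scalemx1.
Qed.

Lemma bounded_pospart_col m t : D t ->
  bounded_measurable D (fun z => (pospart (z - t))%:M : 'M[R]_m).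
Proof.
move=> Dt; exact: (bounded_measurable_pair2
  (K := fun s t => (pospart (s - t))%:M) (@bounded_pospart_mx m) Dt).
Qed.

Variables (M : R -> 'M[R]_n) (N1 N2 : R -> R -> 'M[R]_n).
Hypothesis hM : bounded_measurable D M.
Hypothesis hN1 : bounded_kernel a b N1.
Hypothesis hN2 : bounded_kernel a b N2.

Local Notation N := (opker N1 N2).
Local Notation Y3 := (Y_3 a b B M N1 N2).
Local Notation Y1 := (Y_1 a b B M N1 N2).

(* The kernel [K] above; [opker] is the kernel of [opP] without its [M] term. *)
Definition solker (s e : R) : 'M[R]_n := Ba s e + (pospart (s - e))%:M.

Lemma bounded_solker : bounded_kernel a b solker.
Proof.
by apply: bounded_kernelD; [exact: bounded_B_a|exact: bounded_pospart_mx].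
Qed.

Local Notation posP := (compP a b M N1 N2 (fun s t => (pospart (s - t))%:M)).

Lemma Y_3E z e : D z -> D e -> Y3 z e = compP a b M N1 N2 Ba z e.
Proof.
move=> Dz De; rewrite /Y_3 -addrA (mxint_opker hN1 hN2)//.
exact: bounded_kernel_mxintegrable2 bounded_B_a De.
Qed.

Lemma bounded_Y_3 e : D e -> bounded_measurable D (Y3 ^~ e).
Proof.
move=> De i j.
have /= := bounded_measurable_pair2 (bounded_compP hM hN1 hN2 bounded_B_a) De i j.
by apply: eq_bnd_mfun => t; rewrite inE => Dt; rewrite Y_3E.
Qed.

Lemma compP_solker z e : D z -> D e ->
  compP a b M N1 N2 solker z e = Y3 z e + posP z e.
Proof.
move=> Dz De; rewrite Y_3E// /compP addrACA -mulmxDr -mxintD.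
- by congr (_ + _); apply: eq_mxint => t _; rewrite mulmxDr.
- apply: mxintegrableM; last exact: bounded_kernel_mxintegrable2 bounded_B_a De.
  exact: (bounded_measurable_pair1 (bounded_opker hN1 hN2)).
- apply: mxintegrableM.
    exact: (bounded_measurable_pair1 (bounded_opker hN1 hN2)).
  exact/bounded_mxintegrable/bounded_pospart_col.
Qed.

(** [Y_1] is the kernel of B_a^* P. The integration variable is now the first argument of [N1] and
    [N2], so the lower triangle, where [N1] lives, becomes the range from [e] to [b], and the upper
    one the range from [a] to [e]. *)
Lemma Y_1E s e : D s -> D e ->
  Y1 s e = (Ba e s)^T *m M e + mxint a b (fun z => (Ba z s)^T *m N z e).
Proof.
move=> Ds De; rewrite /Y_1 -addrA; congr (_ + _).
have iB : bounded_measurable D (fun z => (Ba z s)^T).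
  exact/bounded_measurable_trmx/(bounded_measurable_pair2 bounded_B_a).
have := De; rewrite /= in_itv/= => /andP[ae eb].
rewrite (mxint_itvcc _ ae (lexx b)) (mxint_itvcc _ (lexx a) eb).
transitivity (mxint a b (fun z => (Ba z s)^T *m lowker N1 z e) +
              mxint a b (fun z => (Ba z s)^T *m uppker N2 z e)).
  congr (_ + _); apply: eq_mxint => z; rewrite /= in_itv/= => /andP[az zb].
    by rewrite zb andbT scalemxAr.
  by rewrite az scalemxAr.
rewrite -mxintD.
- by apply: eq_mxint => z _; rewrite -mulmxDr.
- apply: mxintegrableM => //.
  exact: bounded_kernel_mxintegrable2 (bounded_lowker hN1) De.
- apply: mxintegrableM => //.
  exact: bounded_kernel_mxintegrable2 (bounded_uppker hN2) De.
Qed.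

Lemma pospart_ge (s t : R) : s <= t -> pospart (t - s) = t - s.
Proof. by move=> st; rewrite /pospart max_r// subr_ge0. Qed.

Lemma pospart_le (s t : R) : t <= s -> pospart (t - s) = 0.
Proof. by move=> ts; rewrite /pospart max_l// subr_le0. Qed.

Lemma mxint_pospart_tail m (F : R -> 'M[R]_m) s : D s ->
  mxint s b (fun e => (e - s) *: F e) =
  mxint a b (fun e => pospart (e - s) *: F e).
Proof.
rewrite /= in_itv/= => /andP[as_ sb]; rewrite (mxint_itvcc _ as_ (lexx b)).
apply: eq_mxint => t; rewrite /= in_itv/= => /andP[_ ->]; rewrite andbT.
rewrite scalerA; congr (_ *: _).
by case: leP => st; [rewrite mul1r pospart_ge|rewrite mul0r pospart_le ?ltW].
Qed.

(** The three summands are B_a^* P B_a, B_a^* P p and p^* P B_a, with p the kernel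
    [pospart (z - e)]. The definition builds the middle one from [Y_1], that is as (B_a^* P) p, and
    it is reassociated by Fubini. *)
Lemma G_3E s th : D s -> D th ->
  G_3 a b B M N1 N2 s th =
  mxint a b (fun z => (Ba z s)^T *m Y3 z th)
  + mxint a b (fun z => (Ba z s)^T *m posP z th)
  + mxint a b (fun z => pospart (z - s) *: Y3 z th).
Proof.
move=> Ds Dth; rewrite /G_3 !mxint_pospart_tail//; congr (_ + _ + _).
have iB : bounded_measurable D (fun z => (Ba z s)^T).
  exact/bounded_measurable_trmx/(bounded_measurable_pair2 bounded_B_a).
have ip : bounded_measurable D (fun z => (pospart (z - th))%:M : 'M[R]_n).
  exact: bounded_pospart_col.
have hN := bounded_opker hN1 hN2.
have hBN : bounded_measurable D (fun e => mxint a b (fun z => (Ba z s)^T *m N z e)).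
  apply: (bounded_measurable_pair1 (K := fun s e => mxint a b (fun z => (Ba z s)^T *m N z e))) Ds.
  exact: (bounded_kernel_mxint (bounded_trmx_kernel bounded_B_a) hN).
transitivity (mxint a b (fun e => (Ba e s)^T *m M e *m (pospart (e - th))%:M) +
    mxint a b (fun e => mxint a b (fun z => (Ba z s)^T *m N z e) *m (pospart (e - th))%:M)).
  rewrite -mxintD.
  - by apply: eq_mxint => e De; rewrite Y_1E// -mulmxDl mul_mx_scalar.
  - apply: bounded_mxintegrable.
    by apply: bounded_measurableM => //; exact: bounded_measurableM.
  - by apply: bounded_mxintegrable; exact: bounded_measurableM.
rewrite -mxint_assoc//; [|exact: bounded_mxintegrable..].
rewrite -mxintD.
- by apply: eq_mxint => z _; rewrite -mulmxA -mulmxDr.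
- apply: bounded_mxintegrable.
  by apply: bounded_measurableM => //; exact: bounded_measurableM.
- apply: mxintegrableM => //; apply: mxintegrable_kernel => //.
  exact: bounded_mxintegrable.
Qed.

(** This is p^* P p. It involves two integration variables, and [e] is always made the larger one,
    so that the integrand lives on e >= max(s, th). In the [M] and [N1] pieces, [F1] and [F2], that
    variable is already outermost; in the [N2] piece [F3] it is the inner one and an exchange of
    order brings it out. The first two pieces give [G_4], the third [G_5]. *)
Lemma mxint_posP s th c : D s -> D th -> c = Num.max s th ->
  mxint a b (fun z => pospart (z - s) *: posP z th) =
  mxint c b (fun e => (e - s) *: G_4 M N1 th e + G_5 N2 s th e).
Proof.
move=> Ds Dth cE.
have Dp t m : D t -> bounded_measurable D (fun z => (pospart (z - t))%:M : 'M[R]_m).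
  exact: bounded_pospart_col.
have ip t m : D t -> mxintegrable a b (fun z => (pospart (z - t))%:M : 'M[R]_m).
  by move=> Dt; exact/bounded_mxintegrable/Dp.
have sm0 : (0 : R)%:M = 0 :> 'M[R]_n by exact: raddf0.
have hl := bounded_lowker hN1; have hu := bounded_uppker hN2.
pose F1 z := (pospart (z - s))%:M *m (M z *m (pospart (z - th))%:M).
pose F2 z := (pospart (z - s))%:M *m
  mxint a b (fun t => lowker N1 z t *m (pospart (t - th))%:M).
pose F3 e := mxint a b (fun z => (pospart (z - s))%:M *m uppker N2 z e) *m
  (pospart (e - th))%:M.
have i1 : mxintegrable a b F1.
  apply: bounded_mxintegrable; apply: bounded_measurableM; first exact: Dp.
  by apply: bounded_measurableM => //; exact: Dp.
have i2 : mxintegrable a b F2.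
  apply: mxintegrableM; first exact: Dp.
  by apply: mxintegrable_kernel => //; exact: ip.
have iu : bounded_measurable D (fun e => mxint a b (fun z => (pospart (z - s))%:M *m uppker N2 z e)).
  apply: (bounded_measurable_pair1
    (K := fun s e => mxint a b (fun z => (pospart (z - s))%:M *m uppker N2 z e))) Ds.
  exact: (bounded_kernel_mxint (bounded_kernel_swap (@bounded_pospart_mx n)) hu).
have i3 : mxintegrable a b F3.
  by apply: bounded_mxintegrable; apply: bounded_measurableM => //; exact: Dp.
transitivity (mxint a b (fun z => F1 z + F2 z + F3 z)).
  rewrite !mxintD//; last exact: mxintegrableD.
  rewrite -(mxint_assoc (ip _ _ Ds) hu (ip _ _ Dth)) -mxintD// -mxintD; last first.
  - apply: mxintegrableM; first exact: Dp.
    by apply: mxintegrable_kernel => //; exact: ip.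
  - exact: mxintegrableD.
  apply: eq_mxint => z Dz; rewrite /compP -mul_scalar_mx -!mulmxDr -addrA -mxintD.
  - congr (_ *m (_ + _)); apply: eq_mxint => t _.
    by rewrite -mulmxDl.
  - by apply: mxintegrableM; [exact: (bounded_measurable_pair1 hl)|exact: ip].
  - by apply: mxintegrableM; [exact: (bounded_measurable_pair1 hu)|exact: ip].
have := Ds; rewrite /= in_itv/= => /andP[as_ sb].
have := Dth; rewrite /= in_itv/= => /andP[ath thb].
have ac : a <= c by rewrite cE le_max as_.
rewrite (mxint_itvcc _ ac (lexx b)); apply: eq_mxint => e De.
have := De; rewrite /= in_itv/= => /andP[ae eb].
(* Below [c] each piece vanishes. If e < s, the inner variable z <= e of [F3] is also below [s]; if
   e < th, the inner variable of [F2] is below [th]; in the remaining cases the factor at [e] itself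
   is 0. *)
rewrite eb andbT; have [|] := leP c e; rewrite cE ?ge_max ?lt_max; last first.
  rewrite scale0r /F1 /F2 /F3 => /orP[es|eth].
    have p0 : pospart (e - s) = 0 by rewrite pospart_le// ltW.
    rewrite p0 !sm0 !mul0mx !add0r (_ : mxint _ _ _ = 0) ?mul0mx//.
    (* Zero is written as an integral, so that the integrands can be compared pointwise. *)
    rewrite -(mul0mx _ (mxint a b (fun _ => 0 : 'M[R]_n))) mulmx_mxint; last first.
      exact/bounded_mxintegrable/bounded_measurable_cst.
    apply: eq_mxint => z _; rewrite mul0mx /uppker; have [ze|ze] := leP z e.
      by rewrite pospart_le ?sm0 ?mul0mx// (le_trans ze)// ltW.
    by rewrite scale0r mulmx0.
  have p0 : pospart (e - th) = 0 by rewrite pospart_le// ltW.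
  rewrite p0 !sm0 !mulmx0 addr0 add0r (_ : mxint _ _ _ = 0) ?mulmx0//.
  rewrite -(mul0mx _ (mxint a b (fun _ => 0 : 'M[R]_n))) mulmx_mxint; last first.
    exact/bounded_mxintegrable/bounded_measurable_cst.
  apply: eq_mxint => z _; rewrite mul0mx /lowker; have [ze|ze] := leP z e.
    by rewrite pospart_le ?sm0 ?mulmx0// (le_trans ze)// ltW.
  by rewrite scale0r mul0mx.
move=> /andP[se the]; rewrite scale1r.
have ps : pospart (e - s) = e - s by rewrite pospart_ge.
have pt : pospart (e - th) = e - th by rewrite pospart_ge.
rewrite /F1 /F2 -mulmxDr ps mul_scalar_mx; congr (_ *: _ + _).
  rewrite /G_4 pt mul_mx_scalar; congr (_ + _).
  rewrite (mxint_itvcc _ ath eb); apply: eq_mxint => z _.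
  rewrite mul_mx_scalar /lowker !scalerA; congr (_ *: _).
  have [ze|ze] := leP z e; rewrite ?andbF ?mulr0 ?mul0r//.
  rewrite andbT mulr1; have [zt|/ltW zt] := leP th z.
    by rewrite pospart_ge// mul1r.
  by rewrite pospart_le// mul0r.
rewrite /F3 pt /G_5 (mxint_itvcc _ as_ eb) mxint_mulmx; last first.
  apply: mxintegrableM; first exact: Dp.
  exact: bounded_kernel_mxintegrable2 hu De.
apply: eq_mxint => z _.
rewrite mul_mx_scalar mul_scalar_mx /uppker !scalerA; congr (_ *: _).
have [ze|ze] := leP z e; rewrite ?andbF ?mulr0 ?mul0r//.
rewrite andbT mulr1; have [zs|/ltW zs] := leP s z.
  by rewrite pospart_ge// mul1r mulrC.
by rewrite pospart_le// mulr0 mul0r.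
Qed.

Lemma sandwichP_G s th : D s -> D th ->
  sandwichP a b M N1 N2 solker s th =
  mxint a b (fun z => pospart (z - s) *: posP z th) + G_3 a b B M N1 N2 s th.
Proof.
move=> Ds Dth.
have iB : bounded_measurable D (fun z => (Ba z s)^T).
  exact/bounded_measurable_trmx/(bounded_measurable_pair2 bounded_B_a).
have ip : bnd_mfun D (fun z => pospart (z - s)).
  apply: (bnd_mfun_comp (h := pair^~ s) (measurable_itvcc_prod a b) _ _ (bnd_mfun_pospart a b)).
    exact/measurable_funTS/pair2_measurable.
  by move=> _ [t Dt <-].
have iY := bounded_Y_3 Dth.
have iP : bounded_measurable D (posP ^~ th).
  exact: (bounded_measurable_pair2 (bounded_compP hM hN1 hN2 (@bounded_pospart_mx _))).
have j1 := bounded_mxintegrable (bounded_measurableM iB iY).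
have j2 := bounded_mxintegrable (bounded_measurableM iB iP).
have j3 := bounded_mxintegrable (bounded_measurableZ ip iY).
have j4 := bounded_mxintegrable (bounded_measurableZ ip iP).
have j12 := mxintegrableD j1 j2; have j123 := mxintegrableD j12 j3.
rewrite G_3E// addrC -(mxintD j1 j2) -(mxintD j12 j3) -(mxintD j123 j4).
apply: eq_mxint => z Dz; rewrite compP_solker// /solker.
have -> : (Ba z s + (pospart (z - s))%:M)^T = (Ba z s)^T + (pospart (z - s))%:M.
  by rewrite linearD/= tr_scalar_mx.
move: (Y3 z th) (posP z th) => Y P.
by rewrite mulmxDl !mulmxDr !mul_scalar_mx addrA.
Qed.

(** [G_1] and [G_2] have the same integrand, and each starts at max(s, th) on its own side of the
    diagonal. On the diagonal both identifications hold. *)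
Lemma sandwichP_T_1 s th : D s -> D th -> th <= s ->
  sandwichP a b M N1 N2 solker s th = T_1 a b B M N1 N2 s th.
Proof.
move=> Ds Dth ths; rewrite sandwichP_G// /T_1 /G_1; congr (_ + _).
by apply: mxint_posP => //; rewrite max_l.
Qed.

Lemma sandwichP_T_2 s th : D s -> D th -> s <= th ->
  sandwichP a b M N1 N2 solker s th = T_2 a b B M N1 N2 s th.
Proof.
move=> Ds Dth ths; rewrite sandwichP_G// /T_2 /G_2; congr (_ + _).
by apply: mxint_posP => //; rewrite max_r.
Qed.

Lemma opP_T (f : R -> 'cV[R]_n) s : mxintegrable a b f -> D s ->
  opP a b (fun=> 0) (T_1 a b B M N1 N2) (T_2 a b B M N1 N2) f s =
  mxint a b (fun th => sandwichP a b M N1 N2 solker s th *m f th).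
Proof.
move=> hf Ds; have := Ds; rewrite /= in_itv/= => /andP[as_ sb].
have iS : mxintegrable a b (fun th => sandwichP a b M N1 N2 solker s th *m f th).
  apply: mxintegrableM => //.
  apply: (bounded_measurable_pair1 (K := sandwichP a b M N1 N2 solker)) Ds.
  exact: (bounded_kernel_mxint (bounded_trmx_kernel bounded_solker)
    (bounded_compP hM hN1 hN2 bounded_solker)).
rewrite /opP mul0mx add0r -(mxint_itvcc_split as_ sb iS).
congr (_ + _); apply: eq_mxint => t; rewrite /= in_itv/= => /andP[t1 t2].
  by rewrite sandwichP_T_1//= in_itv/= t1 (le_trans t2).
by rewrite sandwichP_T_2//= in_itv/= t2 (le_trans as_).
Qed.

End SandwichKernel.

(** * Primitives and weak derivatives *)

Section DuBoisReymond.
Context {R : realType}.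
Local Notation mu := (@lebesgue_measure R).
Variables (a b : R).
Hypothesis ab : a < b.
Local Notation D := (`[a, b]%classic : set R).

Lemma Rintegral_itvcc (c d : R) (f : R -> R) : a <= c -> d <= b ->
  \int[mu]_(t in `[c, d]) f t = \int[mu]_(t in D) ((c <= t <= d)%R%:R * f t).
Proof.
move=> ac db; rewrite Rintegral_mkcond [RHS]Rintegral_mkcond.
apply: eq_Rintegral => t _; rewrite !patchE !mem_setE !in_itv/=.
have [/andP[ct td]|_] := boolP (c <= t <= d).
  by rewrite (le_trans ac ct) (le_trans td db) mul1r.
by rewrite mul0r; case: ifP.
Qed.

Section Supported.
Variables (c d : R) (psi : R -> R).
Hypothesis ac : a < c.
Hypothesis db : d < b.
Hypothesis cpsi : continuous psi.
Hypothesis spsi : forall t, ~~ (c <= t <= d) -> psi t = 0.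

Lemma restrict_supported (E : set R) : `[c, d] `<=` E -> psi \_ E = psi.
Proof.
move=> cdE; apply/funext => t; rewrite patchE; case: ifPn => // tE.
rewrite spsi//; apply/negP => tcd; move/negP: tE; apply.
by rewrite inE; apply: cdE; rewrite /= in_itv.
Qed.

Lemma bnd_mfun_supported : bnd_mfun setT psi.
Proof.
have [/= _ [M [_ hM]]] : bnd_mfun `[c, d] psi.
  split; first by apply: measurable_funTS; exact: continuous_measurable_fun.
  have /compact_bounded[M [_ mrt]] := continuous_compact
    (continuous_subspaceT cpsi) (@segment_compact R c d).
  by exists M; split; rewrite ?num_real // => ? ? ? ?; exact: mrt.
apply/bnd_mfunP; split; first exact: continuous_measurable_fun.
exists (`|M| + 1); first by rewrite addr_ge0.
move=> t _; have [tcd|/spsi ->] := boolP (c <= t <= d); last first.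
  by rewrite normr0 addr_ge0.
by apply: hM; rewrite /= ?in_itv//= ltr_pwDr// ler_norm.
Qed.

Lemma integrable_supported (E : set R) : measurable E ->
  mu.-integrable E (EFin \o psi).
Proof.
move=> mE; have : mu.-integrable setT (EFin \o psi).
  rewrite -(@restrict_supported `[c, d])// -restrict_EFin -integrable_mkcond//.
  apply: continuous_compact_integrable; first exact: segment_compact.
  exact: continuous_subspaceT.
by apply: integrableS.
Qed.

(** Based at minus infinity, it is differentiable at every real number, as [test_function] demands.
    From [a] on it agrees with the primitive based at [a], since [psi] vanishes left of [c]. *)
Definition primitive (t : R) : R := \int[mu]_(s in `]-oo, t]) psi s.

Lemma primitive_itvcc t : a <= t -> primitive t = \int[mu]_(s in `[a, t]) psi s.
Proof.
move=> at_; rewrite /primitive Rintegral_mkcond [RHS]Rintegral_mkcond.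
apply: eq_Rintegral => s _; rewrite !patchE !mem_setE !in_itv/=.
have [as_|sa] := leP a s; first by [].
rewrite /= spsi; first by case: ifP.
by rewrite negb_and -ltNge (lt_trans sa).
Qed.

Hypothesis psi0 : \int[mu]_(t in D) psi t = 0.

(** Left of [c] nothing has been integrated yet; right of [d] the whole integral of [psi] has, and
    it is 0. *)
Lemma primitive_out t : ~~ (c <= t <= d) -> primitive t = 0.
Proof.
rewrite negb_and -!ltNge => /orP[tc|dt].
  rewrite /primitive (eq_Rintegral mu (g := cst 0)) ?Rintegral_cst ?mul0r// => s.
  rewrite inE/= in_itv/= => st.
  by rewrite spsi// negb_and -!ltNge (le_lt_trans st).
rewrite /primitive -psi0 Rintegral_mkcond [RHS]Rintegral_mkcond.
rewrite !restrict_supported//.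
  by apply: subset_itvScc => /=; rewrite bnd_simp ltW.
by move=> s /=; rewrite !in_itv/= => /andP[_ sd]; rewrite (le_trans sd)// ltW.
Qed.

Lemma is_derive_primitive t : derivable primitive t 1 /\ derive1 primitive t = psi t.
Proof.
apply: (@continuous_FTC1 _ psi -oo%O t (t + 1)).
- by rewrite ltrDl.
- exact: integrable_supported.
- by rewrite ltNyr.
- exact: cpsi.
Qed.

Lemma test_primitive : test_function a b primitive.
Proof.
split=> [t||].
- by have [] := is_derive_primitive t.
- by rewrite (_ : derive1 primitive = psi)//; apply/funext => t; have [] := is_derive_primitive t.
- apply: (@subset_trans _ (closure `[c, d])).
    apply: closureS => t /= /eqP ht; rewrite in_itv/=.
    by apply/negPn/negP => /primitive_out.
  rewrite -(closure_id _).1; last exact: itv_closed.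
  move=> t /=; rewrite !in_itv/= => /andP[ct td].
  by rewrite (lt_le_trans ac ct) (le_lt_trans td db).
Qed.

(** Mean zero turns the primitive into a tail integral, the form that appears in
    [weak_derivative_test] when the order of integration is exchanged. *)
Lemma primitive_opp t : D t -> primitive t = - \int[mu]_(s in `[t, b]) psi s.
Proof.
rewrite /= in_itv/= => /andP[at_ tb].
have iD : mu.-integrable D (EFin \o psi) by exact: integrable_supported.
rewrite -(Rintegral_itv_obnd_cbnd (r := t)); last first.
  by apply: integrable_supported.
by rewrite -(Rintegral_itvB iD) ?bnd_simp// psi0 sub0r opprK primitive_itvcc.
Qed.

End Supported.

Variables u v : R -> R.
Hypothesis iu : mu.-integrable D (EFin \o u).
Hypothesis iv : mu.-integrable D (EFin \o v).
Hypothesis uv : forall phi, test_function a b phi ->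
  \int[mu]_(t in D) (derive1 phi t * u t) = - \int[mu]_(t in D) (phi t * v t).

Let V t := \int[mu]_(s in `[a, t]) v s.

Let VE t : D t -> V t = \int[mu]_(s in D) ((s <= t)%R%:R * v s).
Proof.
rewrite /= in_itv/= => /andP[at_ tb]; rewrite /V Rintegral_itvcc//.
by apply: eq_Rintegral => s; rewrite inE/= in_itv/= => /andP[-> _].
Qed.

(** The primitive of [psi] is an admissible test function, with derivative [psi]. Integration by
    parts against [V] is done by Fubini, as [V] is only the integral of an integrable function. *)
Lemma weak_derivative_test (c d : R) (psi : R -> R) : a < c -> d < b ->
  continuous psi -> (forall t, ~~ (c <= t <= d) -> psi t = 0) ->
  \int[mu]_(t in D) psi t = 0 ->
  \int[mu]_(t in D) (psi t * u t) = \int[mu]_(t in D) (psi t * V t).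
Proof.
move=> ac db cpsi spsi psi0.
have := uv (test_primitive ac db cpsi spsi psi0).
rewrite (eq_Rintegral mu (g := fun t => psi t * u t)); last first.
  by move=> t _; have [_ ->] := is_derive_primitive cpsi spsi t.
move=> ->.
have /bnd_mfunP[mpsi [C C0 psiC]] := bnd_mfun_supported cpsi spsi.
pose F (t s : R) : R := psi t * ((s <= t)%R%:R * v s).
have mF : measurable_fun (D `*` D) (fun z : R * R => F z.1 z.2).
  apply: measurable_funM.
    by apply: measurable_fun_fst_itvcc; exact: measurable_funTS.
  apply: measurable_funM; first by have [] := bnd_mfun_ge a b.
  by apply: measurable_fun_snd_itvcc; have /measurable_int/measurable_EFinP := iv.
have iC : mu.-integrable D (EFin \o (fun=> C)).
  exact/bnd_mfun_integrable/bnd_mfun_cst.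
have iav : mu.-integrable D (EFin \o (Num.norm \o v)) by exact: integrable_norm.
have FCv t s : D t -> D s -> `|F t s| <= C * (Num.norm \o v) s.
  move=> _ _; rewrite normrM ler_pM// ?psiC// normrM ler_piMl//.
  by case: (s <= t); rewrite ?normr1 ?normr0.
have Fswap s t : D s -> D t -> `|F t s| <= (Num.norm \o v) s * C.
  by move=> Ds Dt; rewrite mulrC FCv.
have mFswap : measurable_fun (D `*` D) (fun z : R * R => F z.2 z.1).
  apply: measurable_funM.
    by apply: measurable_fun_snd_itvcc; exact: measurable_funTS.
  apply: measurable_funM; first by have [] := bnd_mfun_le a b.
  by apply: measurable_fun_fst_itvcc; have /measurable_int/measurable_EFinP := iv.
transitivity (\int[mu]_(s in D) \int[mu]_(t in D) F t s).
  (* The minus sign of [primitive_opp] cancels that of the weak derivative. The indicator of s <= t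
     in [F] is the tail of [psi] for fixed s and the domain of [V t] for fixed t. *)
  rewrite -[LHS]mulN1r -[in LHS](eq_Rintegral mu (g := fun s => primitive psi s * v s)
    (f := fun s => -1 * \int[mu]_(t in D) F t s)).
    rewrite RintegralZl ?mulrA ?mulrNN ?mul1r//.
    exact: (integrable_dominated mFswap iav iC Fswap).
  move=> s; rewrite inE => Ds.
  rewrite mulN1r (primitive_opp ac cpsi spsi psi0 Ds) mulNr; congr (- _).
  have := Ds; rewrite /= in_itv/= => /andP[as_ sb].
  rewrite (Rintegral_itvcc psi as_ (lexx b)) -RintegralZr//; last first.
    apply: bnd_mfun_integrable.
    apply: (bnd_mfunM (f := fun t => (s <= t <= b)%R%:R) (g := psi)); last first.
      apply/bnd_mfunP; split; first exact: measurable_funTS.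
      by exists C => // t _; exact: psiC.
    apply: bnd_mfun_bool; apply: measurable_and; exact: measurable_fun_ler.
  apply: eq_Rintegral => t; rewrite inE/= in_itv/= => /andP[_ ->].
  by rewrite andbT /F; ring.
rewrite -(Fubini_dominated mF iC iav FCv); apply: eq_Rintegral => t.
rewrite inE => Dt; rewrite VE// RintegralZl//.
have [mle ble] : bnd_mfun D (fun s => (s <= t)%R%:R : R).
  by apply: bnd_mfun_bool; exact: measurable_fun_ler.
exact: (@integrableMr _ _ _ mu _ (measurable_itv _) _ _ mle ble iv).
Qed.

End DuBoisReymond.

(** * Fundamental lemma of the calculus of variations, with continuous compactly supported
    functions *)

Section FundamentalLemma.
Context {R : realType}.
Local Notation mu := (@lebesgue_measure R).

Lemma continuous_maxr (f g : R -> R) : continuous f -> continuous g ->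
  continuous (fun t => Num.max (f t) (g t)).
Proof.
move=> cf cg.
rewrite (_ : (fun t => _) = fun t => (f t + g t + `|f t - g t|) * 2^-1); last first.
  by apply/funext => t; rewrite maxr_absE.
move=> t; apply: cvgM; last exact: cvg_cst.
apply: cvgD; first by apply: cvgD; [exact: cf|exact: cg].
by apply: cvg_norm; apply: cvgB; [exact: cf|exact: cg].
Qed.

Lemma continuous_minr (f g : R -> R) : continuous f -> continuous g ->
  continuous (fun t => Num.min (f t) (g t)).
Proof.
move=> cf cg.
rewrite (_ : (fun t => _) = fun t => (f t + g t - `|f t - g t|) * 2^-1); last first.
  by apply/funext => t; rewrite minr_absE.
move=> t; apply: cvgM; last exact: cvg_cst.
apply: cvgB; first by apply: cvgD; [exact: cf|exact: cg].
by apply: cvg_norm; apply: cvgB; [exact: cf|exact: cg].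
Qed.

(** Trapezoid on [c, d] with sides of slope [m], converging to the indicator of ]c, d[. Continuity
    suffices, since genuine test functions arise as primitives. *)
Definition cutoff (c d : R) (m : nat) (t : R) : R :=
  Num.min 1 (m%:R * Num.max 0 (Num.min (t - c) (d - t))).

Lemma continuous_cutoff c d m : continuous (cutoff c d m).
Proof.
apply: continuous_minr; first by move=> t; exact: cvg_cst.
move=> t; apply: cvgM; first exact: cvg_cst.
move: t; apply: continuous_maxr; first by move=> t; exact: cvg_cst.
apply: continuous_minr => t; apply: cvgB; [exact: cvg_id|exact: cvg_cst|exact: cvg_cst|exact: cvg_id].
Qed.

Lemma cutoff_out c d m t : ~~ (c < t < d) -> cutoff c d m t = 0.
Proof.
rewrite negb_and -!leNgt => ht.
have h : Num.min (t - c) (d - t) <= 0 by rewrite ge_min !subr_le0.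
by rewrite /cutoff (max_l h) mulr0 min_r.
Qed.

Lemma cutoff_norm c d m t : `|cutoff c d m t| <= 1.
Proof.
rewrite /cutoff ger0_norm ?ge_min ?lexx//.
by rewrite le_min ler01 mulr_ge0// le_max lexx.
Qed.

Lemma cutoff_cvg c d t :
  cutoff c d m t @[m --> \oo] --> ((c < t < d)%R%:R : R).
Proof.
have [/andP[ct td]|ntcd] := boolP (c < t < d); last first.
  by under eq_fun do rewrite cutoff_out//; exact: cvg_cst.
set r := Num.min (t - c) (d - t).
have r0 : 0 < r by rewrite /r lt_min !subr_gt0 ct.
apply: cvg_near_cst; near=> m.
rewrite /cutoff -/r max_r ?(ltW r0)// min_l//.
rewrite -ler_pdivrMr// mul1r.
near: m; exact: nbhs_infty_ger.
Unshelve. all: by end_near. Qed.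

Variables (a b : R).
Hypothesis ab : a < b.
Local Notation D := (`[a, b]%classic : set R).

Definition inner_supported (psi : R -> R) : Prop :=
  exists c d, [/\ a < c, d < b & forall t, ~~ (c <= t <= d) -> psi t = 0].

Lemma cutoff_supported c d m : a < c -> d < b -> inner_supported (cutoff c d m).
Proof.
move=> ac db; exists c, d; split=> // t; rewrite negb_and -!ltNge => ht.
apply: cutoff_out; rewrite negb_and -!leNgt.
by case/orP: ht => /ltW ->; rewrite ?orbT.
Qed.

Lemma inner_supported_integrableM psi g : continuous psi -> inner_supported psi ->
  mu.-integrable D (EFin \o g) -> mu.-integrable D (EFin \o (fun t => psi t * g t)).
Proof.
move=> cpsi [c [d [_ _ spsi]]] ig.
have /bnd_mfunP[mpsi [C C0 hC]] := bnd_mfun_supported cpsi spsi.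
have [mp bp] : bnd_mfun D psi.
  apply/bnd_mfunP; split; first exact: measurable_funTS.
  by exists C => // t _; exact: hC.
exact: (@integrableMr _ _ _ mu _ (measurable_itv _) _ _ mp bp ig).
Qed.

(** Dominated convergence with majorant |g|, as the cutoffs are bounded by 1. *)
Lemma cutoff_Rintegral0 (c d : R) (g : R -> R) : a < c -> d < b ->
  mu.-integrable D (EFin \o g) ->
  (forall m, \int[mu]_(t in D) (cutoff c d m t * g t) = 0) ->
  \int[mu]_(t in D) ((c < t < d)%R%:R * g t) = 0.
Proof.
move=> ac db ig h0.
have im m : mu.-integrable D (EFin \o (fun t => cutoff c d m t * g t)).
  apply: inner_supported_integrableM => //; first exact: continuous_cutoff.
  exact: cutoff_supported.
have mind : measurable_fun D (fun t => (c < t < d)%R%:R * g t).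
  apply: measurable_funM; last by have /measurable_int/measurable_EFinP := ig.
  have [] // : bnd_mfun D (fun t => (c < t < d)%R%:R : R).
  by apply: bnd_mfun_bool; apply: measurable_and; exact: measurable_fun_ltr.
have hcv : {ae mu, forall t, D t -> (cutoff c d m t * g t)%:E @[m --> \oo] -->
    ((c < t < d)%R%:R * g t)%:E}.
  apply: aeW => t _; apply/fine_cvgP; split; first exact: nearW.
  by apply: cvgM; [exact: cutoff_cvg|exact: cvg_cst].
have hdom : {ae mu, forall t m, D t ->
    (`|(cutoff c d m t * g t)%:E| <= `|(g t)%:E|)%E}.
  apply: aeW => t m _; rewrite lee_fin normrM ler_piMl//.
  exact: cutoff_norm.
have [_ _ hlim] := @dominated_convergence _ _ _ mu D (measurable_itv _)
  (fun m t => (cutoff c d m t * g t)%:E) (fun t => ((c < t < d)%R%:R * g t)%:E)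
  (fun t => `|(g t)%:E|%E)
  (fun m => measurable_int _ (im m)) ((measurable_EFinP _ _).2 mind) hcv
  (integrable_abse ig) hdom.
move: hlim; rewrite (_ : [sequence _]_n = cst 0%E); last first.
  apply/funext => m /=; have := h0 m; rewrite /Rintegral => h.
  by rewrite -[LHS]fineK ?h//; exact: integrable_fin_num (im m).
by move=> h; rewrite /Rintegral -(cvg_unique _ (@cvg_cst _ 0%E _ _ _) h).
Qed.

(** Fix [psi0] with integral [I0] different from 0. Any [psi] becomes of mean zero after subtracting
    [r] times [psi0], with [r] the quotient of the integrals; the hypothesis for this difference
    gives the claim, [k] being the mean of [w] weighted by [psi0]. *)
Lemma inner_supported_cst (w : R -> R) : mu.-integrable D (EFin \o w) ->
  (forall psi, continuous psi -> inner_supported psi ->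
    \int[mu]_(t in D) psi t = 0 -> \int[mu]_(t in D) (psi t * w t) = 0) ->
  exists k, forall psi, continuous psi -> inner_supported psi ->
    \int[mu]_(t in D) (psi t * (w t - k)) = 0.
Proof.
move=> iw h0.
have i1 : mu.-integrable D (EFin \o (fun=> 1 : R)) by exact/bnd_mfun_integrable/bnd_mfun_cst.
(* The points at one and two thirds: an interval of positive length strictly inside ]a, b[. *)
pose c0 := (2 * a + b) / 3; pose d0 := (a + 2 * b) / 3.
have ac0 : a < c0 by rewrite /c0 ltr_pdivlMr//; move: ab; lra.
have db0 : d0 < b by rewrite /d0 ltr_pdivrMr//; move: ab; lra.
have cd0 : c0 < d0 by rewrite /c0 /d0 ltr_pM2r//; move: ab; lra.
(* If all these integrals vanished, their limit d0 - c0 would vanish too. *)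
have [m m0] : exists m, \int[mu]_(t in D) cutoff c0 d0 m t != 0.
  apply: contrapT => /forallNP h.
  have := @cutoff_Rintegral0 c0 d0 (fun=> 1) ac0 db0 i1.
  have -> : \int[mu]_(t in D) ((c0 < t < d0)%R%:R * 1) = d0 - c0.
    transitivity (\int[mu]_(t in `]c0, d0[) (1 : R)).
      rewrite Rintegral_mkcond [RHS]Rintegral_mkcond; apply: eq_Rintegral => t _.
      rewrite !patchE !mem_setE !in_itv/= mulr1.
      have [/andP[ct td]|_] := boolP (c0 < t < d0); last by case: ifP.
      by rewrite (ltW (lt_trans ac0 ct)) (ltW (lt_trans td db0)).
    rewrite Rintegral_cst// mul1r.
    have := lebesgue_measure_itv `]c0, d0[; rewrite /= lte_fin cd0.
    exact: (congr1 fine).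
  move=> h1; have : d0 - c0 = 0.
    apply: h1 => m; have /negP := h m; rewrite negbK => /eqP <-.
    by apply: eq_Rintegral => t _; rewrite mulr1.
  by apply/eqP; rewrite subr_eq0 gt_eqF.
set psi0 := cutoff c0 d0 m in m0.
have cpsi0 : continuous psi0 by exact: continuous_cutoff.
have spsi0 : inner_supported psi0 by exact: cutoff_supported.
have iM p g : continuous p -> inner_supported p -> mu.-integrable D (EFin \o g) ->
    mu.-integrable D (EFin \o (fun t => p t * g t)).
  exact: inner_supported_integrableM.
set I0 := \int[mu]_(t in D) psi0 t in m0.
pose k := (\int[mu]_(t in D) (psi0 t * w t)) / I0.
exists k => psi cpsi spsi.
pose r := (\int[mu]_(t in D) psi t) / I0.
have ipsi : mu.-integrable D (EFin \o psi).
  have := iM _ _ cpsi spsi i1; apply: eq_integrable_itvcc => t _; exact: mulr1.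
have ipsi0 : mu.-integrable D (EFin \o psi0).
  have := iM _ _ cpsi0 spsi0 i1; apply: eq_integrable_itvcc => t _; exact: mulr1.
have cphi : continuous (fun t => psi t - r * psi0 t).
  move=> t; apply: cvgB; first exact: cpsi.
  by apply: cvgM; [exact: cvg_cst|exact: cpsi0].
have sphi : inner_supported (fun t => psi t - r * psi0 t).
  have [c1 [d1 [ac1 db1 s1]]] := spsi; have [c2 [d2 [ac2 db2 s2]]] := spsi0.
  exists (Num.min c1 c2), (Num.max d1 d2); split.
  - by rewrite lt_min ac1.
  - by rewrite gt_max db1.
  - move=> t; rewrite negb_and -!ltNge lt_min gt_max => ht.
    rewrite s1 ?s2 ?mulr0 ?subr0//; rewrite negb_and -!ltNge.
      by case/orP: ht => /andP[_ ->]; rewrite ?orbT.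
    by case/orP: ht => /andP[-> _]; rewrite ?orbT.
have irp (g : R -> R) q : mu.-integrable D (EFin \o g) ->
    mu.-integrable D (EFin \o (fun t => q * g t)).
  by move=> ig; exact: (@integrableZl _ _ _ mu _ (measurable_itv _) q _ ig).
have := h0 _ cphi sphi.
rewrite RintegralB//; last exact: irp.
rewrite RintegralZl// /r mulfVK// subrr => /(_ erefl).
rewrite (eq_Rintegral mu (g := fun t => psi t * w t - r * (psi0 t * w t))); last first.
  by move=> t _; rewrite mulrBl mulrA.
rewrite RintegralB//; [|exact: iM|by apply: irp; exact: iM].
rewrite RintegralZl//; last exact: iM.
move=> h.
rewrite (eq_Rintegral mu (g := fun t => psi t * w t - k * psi t)); last first.
  by move=> t _; rewrite mulrBr (mulrC k).
rewrite RintegralB//; [|exact: iM|exact: irp].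
rewrite RintegralZl// -[RHS]h /k /r; congr (_ - _).
by rewrite [LHS]mulrC mulrA [RHS]mulrAC.
Qed.

End FundamentalLemma.

(** * Weak derivatives, primitives and continuous representatives *)

Section WeakDerivative.
Context {R : realType}.
Local Notation mu := (@lebesgue_measure R).
Variables (a b : R).
Hypothesis ab : a < b.
Local Notation D := (`[a, b]%classic : set R).

Lemma ae_neq (c : R) : {ae mu, forall t, t != c}.
Proof.
exists [set c]; split=> //; first exact: lebesgue_measure_set1.
by move=> t /= /negP; rewrite negbK => /eqP.
Qed.

(** Increments of the primitive [F] inside ]a, b[ are integrals of [g] over open intervals, hence 0
    by cutoffs. So [F] is locally constant there, while Lebesgue differentiation gives [g] as its
    derivative almost everywhere. *)
Lemma inner_supported_ae0 (g : R -> R) : mu.-integrable D (EFin \o g) ->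
  (forall psi, continuous psi -> inner_supported a b psi ->
    \int[mu]_(t in D) (psi t * g t) = 0) ->
  {ae mu, forall t, D t -> g t = 0}.
Proof.
move=> ig h0; pose gD := g \_ D.
have igD : mu.-integrable setT (EFin \o gD).
  by rewrite -restrict_EFin -integrable_mkcond//; exact: measurable_itv.
have igS (i : interval R) : mu.-integrable [set` i] (EFin \o gD).
  exact: integrableS igD.
pose F x := \int[mu]_(t in `[a, x]) gD t.
have FE x y : a < x -> x < y -> y < b -> F y = F x.
  move=> ax xy yb; apply/eqP; rewrite -subr_eq0; apply/eqP.
  rewrite /F Rintegral_itvB// ?bnd_simp ?ltW//.
  rewrite -Rintegral_itv_bndo_bndc//.
  rewrite -(@cutoff_Rintegral0 R a b x y g ax yb ig).
    rewrite Rintegral_mkcond [RHS]Rintegral_mkcond; apply: eq_Rintegral => t _.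
    rewrite /gD !patchE !mem_setE !in_itv/=.
    have [/andP[xt ty]|_] := boolP (x < t < y); last by rewrite mul0r; case: ifP.
    by rewrite (ltW (lt_trans ax xt)) (ltW (lt_trans ty yb)) mul1r.
  move=> m; apply: h0; first exact: continuous_cutoff.
  exact: cutoff_supported.
have locg : locally_integrable setT gD by apply: integrable_locally.
have := FTC1 (a := BLeft a) (fun y => igS _) locg.
(* The endpoints are discarded because [F] is compared only between points of ]a, b[, so [t] needs
   room on both sides. *)
have := ae_neq a; have := ae_neq b.
apply: filterS3; first exact: (ae_filter_ringOfSetsType mu).
move=> t tb ta ht; rewrite /= in_itv/= => /andP[at_ tb_].
have {}ta : a < t by rewrite lt_neqAle eq_sym ta.
have {}tb : t < b by rewrite lt_neqAle tb.
have [_] := ht (ltac:(by rewrite lte_fin)).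
rewrite /gD patchE mem_set/= ?in_itv/= ?at_ ?tb_// => <-.
rewrite derive1E (near_eq_derive (g := cst (F t))) ?derive_cst//.
near=> y.
have : a < y < b by near: y; apply: near_in_itvoo; rewrite in_itv/= ta.
move=> /andP[ay yb]; rewrite /cst -/(F y).
by have [yt|yt|->//] := ltgtP y t; [apply/esym|]; exact: FE.
Unshelve. all: by end_near. Qed.

(** By [weak_derivative_test], [u] minus the primitive of [v] is orthogonal to every mean-zero
    [psi], hence constant. *)
Lemma dubois_reymond (u v : R -> R) :
  mu.-integrable D (EFin \o u) -> mu.-integrable D (EFin \o v) ->
  (forall phi, test_function a b phi ->
    \int[mu]_(t in D) (derive1 phi t * u t) = - \int[mu]_(t in D) (phi t * v t)) ->
  exists k, {ae mu, forall t, D t -> u t = k + \int[mu]_(s in `[a, t]) v s}.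
Proof.
move=> iu iv uv; pose V t := \int[mu]_(s in `[a, t]) v s.
have iV : mu.-integrable D (EFin \o V).
  apply: continuous_compact_integrable; first exact: segment_compact.
  exact: (parameterized_integral_continuous (ltW ab) iv).
have iw : mu.-integrable D (EFin \o (fun t => u t - V t)).
  exact: (@integrableB _ _ _ mu _ (measurable_itv _) _ _ iu iV).
have [|k hk] := inner_supported_cst ab iw.
  move=> psi cpsi [c [d [ac db spsi]]] psi0.
  have spsi' : inner_supported a b psi by exists c, d.
  rewrite (eq_Rintegral mu (g := fun t => psi t * u t - psi t * V t)); last first.
    by move=> t _; rewrite mulrBr.
  rewrite RintegralB//; [|exact: inner_supported_integrableM..].
  by rewrite (weak_derivative_test iv uv ac db cpsi spsi psi0) subrr.
exists k; have ik : mu.-integrable D (EFin \o (fun=> k)).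
  exact/bnd_mfun_integrable/bnd_mfun_cst.
have iwk : mu.-integrable D (EFin \o (fun t => u t - V t - k)).
  exact: (@integrableB _ _ _ mu _ (measurable_itv _) _ _ iw ik).
have := inner_supported_ae0 iwk hk; apply: filterS; first exact: (ae_filter_ringOfSetsType mu).
move=> t h Dt.
by apply/eqP; rewrite -subr_eq0 opprD addrA addrAC h.
Qed.

(** The interval has finite measure and |y| <= 1 + y^2. *)
Lemma L2_mxintegrable n (u : R -> 'cV[R]_n) : L2 a b u -> mxintegrable a b u.
Proof.
move=> hu i j; rewrite ord1.
have := Lfun2_integrable_sqr (hu i).
have := hu i; rewrite inE => /andP[+ _]; rewrite inE/= => mf i2.
have mu' : measurable_fun D (fun t => u t i ord0).
  by apply/(measurable_restrictT _ _).2.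
have i1 : mu.-integrable D (EFin \o (fun=> 1 : R)).
  exact/bnd_mfun_integrable/bnd_mfun_cst.
have i2' : mu.-integrable D (EFin \o (fun t => u t i ord0 ^+ 2)).
  have : mu.-integrable D (EFin \o (fun t => ((fun t => u t i ord0) \_ D) t ^+ 2)).
    exact: integrableS i2.
  by apply: eq_integrable_itvcc => t Dt; rewrite patchE mem_set.
have := @integrableD _ _ _ mu _ (measurable_itv _) _ _ i1 i2'.
apply: le_integrable => //; first exact/measurable_EFinP.
move=> t Dt; rewrite lee_fin /= [leRHS]ger0_norm ?addr_ge0 ?sqr_ge0//.
set y := u t i ord0; have <- : `|y| ^+ 2 = y ^+ 2 by rewrite real_normK ?num_real.
move: `|y| (sqr_ge0 (`|y| - 1)) (normr_ge0 y) => z; nra.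
Qed.

Lemma weak_derivative_primitive n (u v : R -> 'cV[R]_n) :
  L2 a b u -> weak_derivative a b u v ->
  exists k, {ae mu, forall t, D t -> u t = k + mxint a t v}.
Proof.
move=> hu [hv uv].
have iu := L2_mxintegrable hu; have iv := L2_mxintegrable hv.
have hk i : exists k,
    {ae mu, forall t, D t -> u t i ord0 = k + \int[mu]_(s in `[a, t]) v s i ord0}.
  apply: dubois_reymond => // phi tphi.
  have := congr1 (fun A : 'cV[R]_n => A i ord0) (uv phi tphi).
  rewrite !mxE => h.
  transitivity (\int[mu]_(t in D) (derive1 phi t *: u t) i ord0).
    by apply: eq_Rintegral => t _; rewrite mxE.
  by rewrite h; congr (- _); apply: eq_Rintegral => t _; rewrite mxE.
have [k {}hk] := choice hk.
exists (\col_i k i); have := @filter_forall _ _ _ _ (ae_filter_ringOfSetsType mu) hk.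
apply: (@filterS _ _ (ae_filter_ringOfSetsType mu)) => t ht Dt; apply/matrixP => i j; rewrite ord1 !mxE.
exact: ht.
Qed.

Lemma continuous_primitive n (k : 'cV[R]_n) (v : R -> 'cV[R]_n) :
  mxintegrable a b v -> {within D, continuous (fun t => k + mxint a t v)}.
Proof.
move=> iv; apply/subspace_continuousP => t Dt.
(* A neighbourhood of [t] has to serve all entries at once; there are finitely many, so the
   entrywise neighbourhoods can be intersected. *)
apply/cvg_mx_entourageP => A hA.
pose P (ij : 'I_n * 'I_1) s :=
  ((k + mxint a t v) ij.1 ij.2, (k + mxint a s v) ij.1 ij.2) \in A.
suff hP : forall ij, \forall s \near within D (nbhs t), P ij s.
  have h : \forall s \near within D (nbhs t), forall ij, P ij s.
    exact: filter_forall.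
  change (\forall s \near within D (nbhs t),
    forall i j, ((k + mxint a t v) i j, (k + mxint a s v) i j) \in A).
  by near=> s => i j; have hs : forall ij, P ij s; [near: s|exact: (hs (i, j))].
move=> [i j]; rewrite /P/=.
have := parameterized_integral_continuous (ltW ab) (iv i j).
move=> /subspace_continuousP/(_ t Dt) hc.
have hc' : (k + mxint a s v) i j @[s --> within D (nbhs t)] --> (k + mxint a t v) i j.
  rewrite !mxE; under eq_fun do rewrite !mxE.
  by apply: cvgD; [exact: cvg_cst|exact: hc].
have := hc' [set y | ((k + mxint a t v) i j, y) \in A].
apply; apply/nbhsP; exists A => //.
Unshelve. all: by end_near. Qed.

Lemma ae_witness (P : R -> Prop) (c d : R) : c < d -> {ae mu, forall t, P t} ->
  exists2 t, c < t < d & P t.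
Proof.
move=> cd [N [mN N0 hN]]; apply: contrapT => h.
have : (mu `]c, d[ <= mu N)%E.
  apply: le_measure; rewrite ?inE//.
  by move=> t /=; rewrite in_itv/= => tcd; apply: hN => /= Pt; apply: h; exists t.
rewrite N0; have -> : mu `]c, d[%classic = (d - c)%:E.
  by have := lebesgue_measure_itv `]c, d[; rewrite /= lte_fin cd EFinB.
by rewrite lee_fin subr_le0 leNgt cd.
Qed.

(** If the functions differed at [t], they would differ at all points of the interval near [t], a
    set of positive measure. *)
Lemma continuous_ae_eq (f g : R -> R) :
  {within D, continuous f} -> {within D, continuous g} ->
  {ae mu, forall t, D t -> f t = g t} -> forall t, D t -> f t = g t.
Proof.
move=> /subspace_continuousP cf /subspace_continuousP cg fg t Dt.
apply/eqP; rewrite -subr_eq0; apply: contrapT => /negP ne0.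
have hc : (f s - g s) @[s --> within D (nbhs t)] --> f t - g t.
  by apply: cvgB; [exact: cf|exact: cg].
have e0 : 0 < `|f t - g t| by rewrite normr_gt0.
have /cvgrPdist_lt/(_ _ e0) := hc.
rewrite near_withinE => -[e /= e_gt0 he].
have := Dt; rewrite /= in_itv/= => /andP[at_ tb].
(* Intersecting with ]a, b[ leaves a nonempty open interval even when [t] is an endpoint. *)
have cd : Num.max a (t - e) < Num.min b (t + e).
  by rewrite lt_min !gt_max ab/=; apply/and3P; split; lra.
have [s /andP[cs sd] hs] := ae_witness cd fg.
move: cs sd; rewrite gt_max lt_min => /andP[as_ ts] /andP[sb st].
have Ds : D s by rewrite /= in_itv/= !ltW.
have : `|f t - g t - (f s - g s)| < `|f t - g t|.
  by apply: he => //=; rewrite ltr_distl; apply/andP; split; lra.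
by rewrite hs// subrr subr0 ltxx.
Qed.

(** The primitive is a continuous representative, so [xget] does not return its default; whichever
    representative it chooses agrees with the primitive at each point by [continuous_ae_eq], applied
    entrywise. *)
Lemma value_at_primitive n (u v : R -> 'cV[R]_n) (k : 'cV[R]_n) :
  mxintegrable a b v -> {ae mu, forall t, D t -> u t = k + mxint a t v} ->
  forall t, D t -> value_at a b u t = k + mxint a t v.
Proof.
move=> iv hk t Dt; rewrite /value_at.
have ck := @continuous_primitive n k v iv.
have [|cc hc] := @xgetPex _ u [set c | continuous_representative a b u c].
  exists (fun t => k + mxint a t v); split=> //.
  apply: filterS hk; first exact: (ae_filter_ringOfSetsType mu).
  by move=> s hs Ds; rewrite hs.
set c := xget _ _ in cc hc *.
apply/matrixP => i j.
have comp (f : R -> 'cV[R]_n) : {within D, continuous f} ->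
    {within D, continuous (fun t => f t i j)}.
  move=> /subspace_continuousP cf; apply/subspace_continuousP => s Ds.
  have h := cvg_comp f (fun A : 'cV[R]_n => A i j) (cf s Ds) (@coord_continuous R n 1 i j (f s)).
  exact: h.
apply: (continuous_ae_eq (comp _ cc) (comp _ ck)) Dt.
apply: filterS2 hk hc; first exact: (ae_filter_ringOfSetsType mu).
by move=> s h1 h2 Ds; rewrite h2// h1.
Qed.

End WeakDerivative.

(** * Representation of the solution *)

Section Representation.
Context {R : realType} {n : nat}.
Local Notation mu := (@lebesgue_measure R).
Variables (a b : R).
Hypothesis ab : a < b.
Local Notation D := (`[a, b]%classic : set R).

Definition mxmeasurable m p (F : R -> 'M[R]_(m, p)) : Prop :=
  forall i j, measurable_fun D (fun t => F t i j).

Lemma mxintegrable_measurable m p (F : R -> 'M[R]_(m, p)) :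
  mxintegrable a b F -> mxmeasurable F.
Proof. by move=> iF i j; have /measurable_int/measurable_EFinP := iF i j. Qed.

Lemma mxmeasurableM m p q (F : R -> 'M[R]_(m, p)) (G : R -> 'M[R]_(p, q)) :
  mxmeasurable F -> mxmeasurable G -> mxmeasurable (fun t => F t *m G t).
Proof.
move=> mF mG i j.
apply: (eq_measurable_fun (fun t => \sum_k F t i k * G t k j)).
  by move=> t _; rewrite mxE.
by apply: measurable_sum => k; exact: measurable_funM.
Qed.

Lemma ae_eq_mxint m p (F G : R -> 'M[R]_(m, p)) :
  mxmeasurable F -> mxmeasurable G ->
  {ae mu, forall t, D t -> F t = G t} -> mxint a b F = mxint a b G.
Proof.
move=> mF mG FG; apply/matrixP => i j; rewrite !mxE /Rintegral; congr fine.
apply: ae_eq_integral => //.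
- by apply/measurable_EFinP; exact: mF.
- by apply/measurable_EFinP; exact: mG.
- by apply: (@filterS _ _ (ae_filter_ringOfSetsType mu)) FG => t FG Dt; rewrite FG.
Qed.

Lemma mxint_cst m p (c d : R) (A : 'M[R]_(m, p)) : c <= d ->
  mxint c d (fun=> A) = (d - c) *: A.
Proof.
move=> cd; apply/matrixP => i j; rewrite !mxE Rintegral_cst// mulrC; congr (_ * _).
have := lebesgue_measure_itv `[c, d]; rewrite /= lte_fin.
case: ltgtP cd => // [_ _|-> _]; first exact: (congr1 fine).
by rewrite subrr; exact: (congr1 fine).
Qed.

(** Cauchy's formula for repeated integration: after the exchange of order, f(e) is weighted by the
    length of [e, t]. *)
Lemma mxint_primitive (f : R -> 'cV[R]_n) (k : 'cV[R]_n) t :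
  mxintegrable a b f -> D t ->
  mxint a t (fun s => k + mxint a s f) =
  (t - a) *: k + mxint a b (fun e => pospart (t - e) *: f e).
Proof.
move=> hf Dt; have := Dt; rewrite /= in_itv/= => /andP[at_ tb].
(* The indicator of e <= s as a scalar matrix, so that [mxint_assoc] applies to it. *)
pose ge (s e : R) : 'M[R]_n := (e <= s)%R%:R%:M.
have hge : bounded_kernel a b ge.
  move=> i j; apply: (eq_bnd_mfun (f := fun z : R * R => (z.2 <= z.1)%R%:R * (i == j)%:R)).
    by move=> z _; rewrite /ge mxE mulr_natr.
  by apply: bnd_mfunM; [exact: bnd_mfun_ge|exact: bnd_mfun_cst].
have hh s : D s -> mxint a s f = mxint a b (fun e => ge s e *m f e).
  rewrite /= in_itv/= => /andP[as_ sb]; rewrite (mxint_itvcc _ (lexx a) sb).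
  by apply: eq_mxint => e; rewrite /= in_itv/= => /andP[-> _]; rewrite mul_scalar_mx.
have ik : mxintegrable a b (fun=> k).
  exact/bounded_mxintegrable/bounded_measurable_cst.
have igt : bounded_measurable D (ge t) by exact: (bounded_measurable_pair1 hge).
rewrite (mxint_itvcc _ (lexx a) tb).
transitivity (mxint a b (fun s => ge t s *m k) +
    mxint a b (fun s => ge t s *m mxint a b (fun e => ge s e *m f e))).
  rewrite -mxintD.
  - apply: eq_mxint => s Ds; have := Ds; rewrite /= in_itv/= => /andP[-> _].
    by rewrite -mulmxDr mul_scalar_mx -hh.
  - exact: mxintegrableM.
  - by apply: mxintegrableM => //; exact: mxintegrable_kernel.
congr (_ + _).
  rewrite -mxint_cst// (mxint_itvcc _ (lexx a) tb).
  by apply: eq_mxint => s; rewrite /= in_itv/= => /andP[-> _]; rewrite mul_scalar_mx.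
rewrite mxint_assoc//; last exact: bounded_mxintegrable.
apply: eq_mxint => e De; have := De; rewrite /= in_itv/= => /andP[ae eb].
rewrite -[in RHS]mul_scalar_mx; congr (_ *m _).
have [et|te] := leP e t.
  rewrite pospart_ge// -[RHS]scalemx1 -mxint_cst// (mxint_itvcc _ ae tb).
  apply: eq_mxint => s _; rewrite /ge -scalar_mxM -natrM mulnb scalemx1.
  by rewrite andbC.
rewrite pospart_le ?ltW//.
transitivity (mxint a b (fun=> 0 : 'M[R]_n)); last first.
  by rewrite mxint_cst ?ltW// scaler0 (raddf0 (@scalar_mx R n)).
apply: eq_mxint => s _; rewrite /ge -scalar_mxM -natrM mulnb.
have [st|] := leP s t; have [es|] := leP e s; rewrite /= ?(raddf0 (@scalar_mx R n))//.
by have := le_lt_trans (le_trans es st) te; rewrite ltxx.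
Qed.

Variable B : 'M[R]_(n + n, (n + n) + (n + n)).
Hypothesis hB2 : B_2 a b B \in unitmx.

(** Taylor's formula makes the boundary values affine in (k0, k1), the values at [a], with
    remainders g0 and g1 at [b]. [B_2] collects the coefficients of (k0, k1), and the other factor
    of [B_3] those of (g0, g1). *)
Lemma boundary_coef (k0 k1 g0 g1 : 'cV[R]_n) :
  B *m col_mx (col_mx k0 (k0 + (b - a) *: k1 + g0)) (col_mx k1 (k1 + g1)) = 0 ->
  col_mx k0 k1 = B_3 a b B *m col_mx g0 g1.
Proof.
move=> h.
have h2 : B_2 a b B *m col_mx k0 k1 + B *m
     col_mx (col_mx (row_mx 0 0) (row_mx 1%:M 0))
            (col_mx (row_mx 0 0) (row_mx 0 1%:M)) *m col_mx g0 g1 = 0.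
  rewrite /B_2 -!mulmxA -mulmxDr -[RHS]h; congr (_ *m _).
  rewrite !mul_col_mx !mul_row_col !mul1mx !mul0mx mul_scalar_mx.
  by rewrite !add_col_mx !addr0 !add0r.
rewrite /B_3 mulNmx -!mulmxA -[LHS](mulKmx hB2); apply/eqP.
rewrite -addr_eq0 -mulmxDr !mulmxA in h2 *.
by rewrite h2 mulmx0.
Qed.

(** The row (1, t - a) times [B_3] is (B_4, B_5). The remainder of the function carries the weight b
    - e and that of its derivative the weight 1, whence the combination (b - e) B_4 + B_5 that
    defines [B_a]. *)
Lemma solker_solution (f : R -> 'cV[R]_n) (k0 k1 : 'cV[R]_n) t :
  mxintegrable a b f -> D t ->
  col_mx k0 k1 = B_3 a b B *m
    col_mx (mxint a b (fun e => (b - e) *: f e)) (mxint a b f) ->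
  k0 + (t - a) *: k1 + mxint a b (fun e => pospart (t - e) *: f e) =
  mxint a b (fun e => solker a b B t e *m f e).
Proof.
move=> hf Dt hk.
have hb : bnd_mfun D (fun e => b - e).
  apply: (eq_bnd_mfun (f := fun t : R => (- 1) * (t - b))).
    by move=> e _; ring.
  apply: bnd_mfunM; first exact: bnd_mfun_cst.
  by apply: bnd_mfunD; [exact: bnd_mfun_itvcc_id|exact: bnd_mfun_cst].
have ibf : mxintegrable a b (fun e => (b - e) *: f e).
  move=> i j; apply: (eq_integrable_itvcc (f := fun e => (b - e) * f e i j)).
    by move=> e _; rewrite mxE.
  exact: (@integrableMr _ _ _ mu _ (measurable_itv _) _ _ hb.1 hb.2 (hf i j)).
have iA (A : 'M[R]_n) (g : R -> 'cV[R]_n) : mxintegrable a b g ->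
    mxintegrable a b (fun e => A *m g e).
  by apply: mxintegrableM; exact: bounded_measurable_cst.
have ip : mxintegrable a b (fun e => pospart (t - e) *: f e).
  have hp := bounded_measurable_pair1 (K := fun s e => (pospart (s - e))%:M : 'M[R]_n)
    (@bounded_pospart_mx R a b n) Dt.
  rewrite (_ : (fun e => _) = fun e => (pospart (t - e))%:M *m f e).
    exact: mxintegrableM hp hf.
  by apply/funext => e; rewrite mul_scalar_mx.
have -> : k0 + (t - a) *: k1 = row_mx 1%:M (t - a)%:M *m col_mx k0 k1.
  by rewrite mul_row_col mul1mx mul_scalar_mx.
rewrite hk mulmxA -/(B_45 a b B t) -[B_45 a b B t]hsubmxK mul_row_col.
rewrite -/(B_4 a b B t) -/(B_5 a b B t) !mulmx_mxint//.
have i4 := iA (B_4 a b B t) _ ibf; have i5 := iA (B_5 a b B t) _ hf.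
rewrite -(mxintD i4 i5) -(mxintD (mxintegrableD i4 i5) ip).
apply: eq_mxint => e _; rewrite /solker /B_a !mulmxDl mul_scalar_mx.
by rewrite -scalemxAl -scalemxAr.
Qed.

End Representation.

(** The kernel representation of x holds only almost everywhere, whereas [opP] is evaluated
    pointwise. Replacing x by [y] alters the multiplication term on a null set of [s] and the
    integral term, for fixed [s], not at all. *)
Lemma L2_inner_ae {R : realType} {n : nat} (a b : R) (M : R -> 'M[R]_n)
    (N1 N2 : R -> R -> 'M[R]_n) (x y : R -> 'cV[R]_n) :
  bounded_measurable `[a, b] M -> bounded_kernel a b N1 -> bounded_kernel a b N2 ->
  mxintegrable a b x -> mxintegrable a b y ->
  {ae @lebesgue_measure R, forall t, `[a, b]%classic t -> x t = y t} ->
  L2_inner a b x (opP a b M N1 N2 x) =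
  mxint a b (fun s => (y s)^T *m opP a b M N1 N2 y s) ord0 ord0.
Proof.
move=> hM hN1 hN2 ix iy xy; have hN := bounded_opker hN1 hN2.
transitivity (mxint a b (fun s => (x s)^T *m opP a b M N1 N2 x s) ord0 ord0).
  by rewrite mxE.
pose P (z : R -> 'cV[R]_n) (s : R) : 'cV[R]_n :=
  M s *m z s + mxint a b (fun t => opker N1 N2 s t *m z t).
have iP z : mxintegrable a b z -> mxintegrable a b (P z).
  move=> iz; apply: mxintegrableD; first exact: mxintegrableM.
  exact: mxintegrable_kernel.
have PE z : mxintegrable a b z ->
    mxint a b (fun s => (z s)^T *m opP a b M N1 N2 z s) =
    mxint a b (fun s => (z s)^T *m P z s).
  by move=> iz; apply: eq_mxint => s Ds; rewrite (opP_opker _ hN1 hN2).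
have mP z : mxintegrable a b z -> mxmeasurable a b (fun s => (z s)^T *m P z s).
  move=> iz; apply: mxmeasurableM.
    exact: mxintegrable_measurable (mxintegrable_trmx iz).
  exact: mxintegrable_measurable (iP _ iz).
rewrite (PE x ix) (PE y iy).
rewrite (ae_eq_mxint (mP x ix) (mP y iy))//.
apply: (@filterS _ _ (ae_filter_ringOfSetsType _)) (xy) => s xys Ds.
  rewrite /P xys//; congr (_ *m (_ + _)).
  have mN (z : R -> 'cV[R]_n) : mxintegrable a b z ->
      mxmeasurable a b (fun t => opker N1 N2 s t *m z t).
    move=> iz; apply: mxintegrable_measurable.
    apply: (mxintegrableM _ iz); exact: (bounded_measurable_pair1 hN Ds).
  apply: ae_eq_mxint; [exact: mN|exact: mN|].
  by apply: (@filterS _ _ (ae_filter_ringOfSetsType _)) xy => t xyt Dt; rewrite xyt.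
Qed.

Theorem lemma6 (R : realType) (a b : R) (hab : a < b) (n : nat) (hn : (1 <= n)%N)
    (B : 'M[R]_(n + n, (n + n) + (n + n)))
    (hB : \rank B = (n + n)%N)
    (hB2 : B_2 a b B \in unitmx)
    (M : R -> 'M[R]_n) (N1 N2 : R -> R -> 'M[R]_n)
    (hM : bounded_measurable `[a, b] M)
    (hN1 : bounded_measurable (`[a, b] `*` `[a, b])
             (fun p : R * R => N1 p.1 p.2))
    (hN2 : bounded_measurable (`[a, b] `*` `[a, b])
             (fun p : R * R => N2 p.1 p.2))
    (x x_s x_ss : R -> 'cV[R]_n)
    (hx : sobolev2 3 a b x)
    (hx_s : weak_derivative a b x x_s)
    (hx_ss : weak_derivative a b x_s x_ss)
    (hbc : B *m col_mx (col_mx (value_at a b x a) (value_at a b x b))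
                       (col_mx (value_at a b x_s a) (value_at a b x_s b)) = 0) :
  L2_inner a b x (opP a b M N1 N2 x) =
  L2_inner a b x_ss
    (opP a b (fun _ => 0) (T_1 a b B M N1 N2) (T_2 a b B M N1 N2) x_ss).
Proof.
have ix := L2_mxintegrable hx.1.
have ix_s := L2_mxintegrable hx_s.1.
have hf := L2_mxintegrable hx_ss.1.
have [k0 hk0] := weak_derivative_primitive hab hx.1 hx_s.
have [k1 hk1] := weak_derivative_primitive hab hx_s.1 hx_ss.
have Da : (`[a, b]%classic : set R) a by rewrite /= in_itv/= lexx ltW.
have Db : (`[a, b]%classic : set R) b by rewrite /= in_itv/= lexx ltW.
(* This holds at every [t], since [x_s] is replaced by its primitive only under an integral; it can
   thus be used at the endpoints. *)
have xE t : (`[a, b]%classic : set R) t -> k0 + mxint a t x_s =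
    k0 + (t - a) *: k1 + mxint a b (fun e => pospart (t - e) *: x_ss e).
  move=> Dt; have := Dt; rewrite /= in_itv/= => /andP[at_ tb].
  rewrite -addrA -(mxint_primitive hab k1 hf Dt); congr (_ + _).
  have sub (F : R -> 'cV[R]_n) : mxmeasurable a b F -> mxmeasurable a t F.
    move=> mF i j; apply: measurable_funS (mF i j) => //.
    by move=> s /=; rewrite !in_itv/= => /andP[-> /le_trans->].
  have i1 : mxintegrable a b (fun s => k1 + mxint a s x_ss).
    move=> i j; apply: continuous_compact_integrable; first exact: segment_compact.
    apply/subspace_continuousP => s Ds.
    have /subspace_continuousP/(_ s Ds) h := @continuous_primitive R a b hab n k1 x_ss hf.
    have := cvg_comp _ (fun A : 'cV[R]_n => A i j) h (@coord_continuous R n 1 i j _).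
    exact.
  apply: ae_eq_mxint; [|by apply: sub; exact: mxintegrable_measurable|].
    by apply: sub; exact: mxintegrable_measurable ix_s.
  apply: (@filterS _ _ (ae_filter_ringOfSetsType _)) hk1 => s hk1.
  by rewrite /= in_itv/= => /andP[as_ st]; apply: hk1; rewrite /= in_itv/= as_ (le_trans st).
(* Taylor's remainder at [b], where [pospart (b - e)] is b - e. *)
pose g0 := mxint a b (fun e => (b - e) *: x_ss e).
have hk : col_mx k0 k1 = B_3 a b B *m col_mx g0 (mxint a b x_ss).
  apply: (boundary_coef hB2); rewrite -[RHS]hbc; congr (_ *m col_mx (col_mx _ _) (col_mx _ _)).
  - rewrite (value_at_primitive hab ix_s hk0 Da) xE// subrr scale0r addr0.
    rewrite (_ : mxint a b _ = 0) ?addr0//.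
    transitivity (mxint a b (fun=> 0 : 'cV[R]_n)); last by rewrite mxint_cst ?ltW// scaler0.
    apply: eq_mxint => e; rewrite /= in_itv/= => /andP[ae _].
    by rewrite pospart_le// scale0r.
  - rewrite (value_at_primitive hab ix_s hk0 Db) xE//; congr (_ + _).
    apply: eq_mxint => e; rewrite /= in_itv/= => /andP[_ eb].
    by rewrite pospart_ge.
  - rewrite (value_at_primitive hab hf hk1 Da).
    apply/matrixP => i j; rewrite !mxE set_itv1 Rintegral_set1.
    by rewrite addr0.
  - by rewrite (value_at_primitive hab hf hk1 Db).
pose y s := mxint a b (fun e => solker a b B s e *m x_ss e).
have hK := @bounded_solker R n a b B.
have iy : mxintegrable a b y by exact: mxintegrable_kernel.
have xy : {ae @lebesgue_measure R, forall t, `[a, b]%classic t -> x t = y t}.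
  apply: (@filterS _ _ (ae_filter_ringOfSetsType _)) hk0 => t hk0 Dt.
  by rewrite hk0// xE// (solker_solution hf Dt hk).
rewrite (L2_inner_ae hM hN1 hN2 ix iy xy) (inner_sandwichP hM hN1 hN2 hK hf).
rewrite [RHS](_ : _ = mxint a b (fun s => (x_ss s)^T *m
  opP a b (fun=> 0) (T_1 a b B M N1 N2) (T_2 a b B M N1 N2) x_ss s) ord0 ord0); last first.
  by rewrite mxE.
congr (fun_of_matrix _ _ _); apply: eq_mxint => s Ds.
by rewrite (opP_T B hM hN1 hN2 hf Ds).
Qed.
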